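(* Let $\widetilde{W}/W\in\{\widetilde{C}_n/C_n,\widetilde{B}_n/B_n,\widetilde{B}_n/D_n,\widetilde{D}_n/D_n\}$ and let $a=\mathcal{A}(w)$ be the abacus of an element $w\in\widetilde{W}/W$. The bounded partition $\mathcal{B}(a)=\mathcal{B}(w)$ is found by creating one part for each bead $b>N$ of $a$, in descending order, as follows: - For each bead $b>N+n$, create a part of size equal to the number of gaps between $b$ and $b-N$ plus $1+x_0+x_n$. - For each bead $b$ with $N+1\le b\le N+n$, create a part of size equal to $b-N$ plus $x_0$. If $b=N+n$ in types $\widetilde{B}/D$ and $\widetilde{D}/D$, then star the resulting part.
   Context: Offsets: $x_0=0$ in types $\widetilde{C}/C,\widetilde{B}/D$ and $x_0=-1$ in types $\widetilde{B}/B,\widetilde{D}/D$; $x_n=0$ in types $\widetilde{C}/C,\widetilde{B}/B$ and $x_n=-1$ in types $\widetilde{B}/D,\widetilde{D}/D$. Groups. Let $N=2n+1$. A mirrored $\mathbb{Z}$-permutation is a bijection $w:\mathbb{Z}\to\mathbb{Z}$ with $w(i+N)=w(i)+N$ and $w(-i)=-w(i)$ for all $i\in\mathbb{Z}$; it is determined by $(w(1),\dots,w(n))$. Under composition these form the affine Coxeter group $\widetilde{C}_n$. Define elements by their images $(w(1),\dots,w(n))$: $s_i=(1,\dots,i-1,i+1,i,i+2,\dots,n)$ for $1\le i\le n-1$; $s_0^C=(-1,2,3,\dots,n)$; $s_0^D=(-2,-1,3,\dots,n)$; $s_n^C=(1,\dots,n-1,n+1)$; $s_n^D=(1,\dots,n-2,n+1,n+2)$.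 The four types are: - $\widetilde{C}/C$: $\widetilde{W}$ is all mirrored $\mathbb{Z}$-permutations, generators $s_0=s_0^C,s_1,\dots,s_{n-1},s_n=s_n^C$ ($n\ge2$). - $\widetilde{B}/B$: those with $|\{i\le0:w(i)\ge1\}|$ even, generators $s_0=s_0^D,s_1,\dots,s_{n-1},s_n=s_n^C$ ($n\ge3$). - $\widetilde{B}/D$: those with $|\{i\le n:w(i)\ge n+1\}|$ even, generators $s_0=s_0^C,s_1,\dots,s_{n-1},s_n=s_n^D$ ($n\ge3$). - $\widetilde{D}/D$: those satisfying both parity conditions, generators $s_0=s_0^D,s_1,\dots,s_{n-1},s_n=s_n^D$ ($n\ge4$). $W$ is generated by $s_1,\dots,s_n$, and $\widetilde{W}/W$ denotes the set of minimal length representatives of the cosets $wW$; $\widetilde{W}$ acts on it by left multiplication of cosets. Abaci and cores. An abacus has runners (columns) $1,\dots,2n$; runner $i$ has entries labeled $mN+i$ for each level $m\in\mathbb{Z}$; some entries are beads, the others gaps; reading order is the order of labels; ''lowest'' means largest label; the abacus is flush if no bead is preceded by a gap on its runner. $\mathcal{A}(w)$ is the flush abacus whose lowest bead in each runner is an element of $\{w(1),\dots,w(2n)\}$. $\mathcal{C}(w)$ is the partition whose southeast boundary is the lattice path obtained by reading the entries of $\mathcal{A}(w)$ in reading order, recording a north-step for each bead and an east-step for each gap (first row at the top). $w\mapsto\mathcal{C}(w)$ is injective on $\widetilde{W}/W$, and $\widetilde{W}$ acts on its image by transport of structure. Residues. Entries of $\mathbb{N}^2$ are $(i,j)$ = (row,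 column); the $k$-th diagonal is $\{j-i=k\}$ and the main diagonal is $k=0$. Write $p\,\|\,q$ for the element of $\{0,\dots,q-1\}$ congruent to $p$ mod $q$. The fixed residue of $(i,j)$ is $(j-i)\|(2n)$ if this is $\le n$, and $2n-((j-i)\|(2n))$ otherwise. An escalator is a connected component of the cells with $(j-i)\|(2n)\in\{n-1,n,n+1\}$; a descalator is a connected component of the cells with $(j-i)\|(2n)\in\{0,1,2n-1\}$; upper means above the main diagonal, lower means below; the descalator containing the main diagonal is the main descalator. Given $\lambda$, let a row meet an upper escalator in cells $c_1,c_2,c_3$ (left to right): if the row of $\lambda$ ends immediately left of $c_1$, then $c_1$ has both residues $n-1,n$, $c_2$ has residue $n$, $c_3$ undefined; if it ends at $c_1$: residues $n-1,n,n$; if it ends at $c_2$: $n,n,n-1$; if it ends at $c_3$: $c_1$ undefined, $c_2$ has residue $n$, $c_3$ has both residues $n-1,n$; otherwise undefined. Upper descalators: the same rule with $n-1$ replaced by $1$ and $n$ by $0$. Lower escalators/descalators: transposed rule, column by column. Main descalator: residue $0$ if $i=j$; if $|i-j|=1$, residue $1$ when $i+j\equiv1$ mod $4$ and $0$ when $i+j\equiv3$ mod $4$. Type $\widetilde{C}/C$ uses fixed residues only; $\widetilde{B}/B$ uses the descalator rules on descalators; $\widetilde{B}/D$ uses the escalator rules on escalators; $\widetilde{D}/D$ uses both; all remaining cells have their fixed residue. Central peeling procedure. The reference diagonal is the main diagonal in types $\widetilde{C}/C,\widetilde{B}/D$ and the first diagonal in types $\widetilde{B}/B,\widetilde{D}/D$.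 Start with $\lambda^{(1)}=\lambda=\mathcal{C}(w)$. At step $i$ (while $\lambda^{(i)}$ is nonempty) let $d^{(i)}$ be the number of boxes of $\lambda^{(i)}$ on the reference diagonal, $B_i$ the box at the end of the $d^{(i)}$-th row of $\lambda^{(i)}$, and $r_i$ its residue; if $B_i$ is both $n$-removable and $(n-1)$-removable (has both residues), set $r_i=n$. Let $\lambda^{(i+1)}$ be the result of $s_{r_i}$ acting on $\lambda^{(i)}$. The upper diagram $U_\lambda$ is the set of boxes $B_i$ encountered, with the following conditions: in types $\widetilde{B}/D,\widetilde{D}/D$, an application of $s_n^D$ removes two boxes from row $d^{(i)}$ and the box not on the $n$-th diagonal is recorded; in types $\widetilde{B}/B,\widetilde{D}/D$, an application of $s_0^D$ removes two boxes from row $d^{(i)}$ and the box not on the main or $2n$-th diagonal is recorded. Each recorded box carries the residue $r_i$. Bounded partition. $\mathcal{B}(w)$ is the partition $\beta$ whose $i$-th part is the number of boxes in row $i$ of $U_\lambda$ (zero parts are disregarded). In type $\widetilde{B}/D$ (respectively $\widetilde{D}/D$), if there is a part of size $n$ (respectively $n-1$) and the last (lowest) part of this size has rightmost box in $U_\lambda$ with residue $n-1$, then that part is adorned with a star. *)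

(* Defs.v *)
From mathcomp Require Import all_boot all_order all_algebra zify.

Set Implicit Arguments.
Unset Strict Implicit.
Unset Printing Implicit Defensive.

Import Order.TTheory GRing.Theory Num.Theory.
Local Open Scope ring_scope.

(* XY stands for the type X~/Y. *)
Inductive affine_type := CC | BB | BD | DD.

Definition min_rank (t : affine_type) : nat :=
  match t with CC => 2 | BB | BD => 3 | DD => 4 end.

Definition x0 (t : affine_type) : int :=
  match t with CC | BD => 0 | BB | DD => -1 end.

Definition xn (t : affine_type) : int :=
  match t with CC | BB => 0 | BD | DD => -1 end.

(* Whether the generator s_0, resp. s_n, is s_0^D, resp. s_n^D. *)
Definition left_fork (t : affine_type) : bool :=
  match t with BB | DD => true | CC | BD => false end.

Definition right_fork (t : affine_type) : bool :=
  match t with BD | DD => true | CC | BB => false end.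

Definition NN (n : nat) : int := (n.*2.+1)%:Z.

(** * Mirrored permutations and the groups *)

Definition mirrored (n : nat) (w : int -> int) : Prop :=
  [/\ bijective w, forall i, w (i + NN n) = w i + NN n
    & forall i, w (- i) = - w i].

(* The finiteness of the set is part of the definition. *)
Definition even_card (P : pred int) : Prop :=
  exists s : seq int, [/\ uniq s, forall i, (i \in s) = P i & ~~ odd (size s)].

Definition in_group (t : affine_type) (n : nat) (w : int -> int) : Prop :=
  [/\ mirrored n w,
      left_fork t -> even_card (fun i => (i <= 0) && (1 <= w i))
    & right_fork t -> even_card (fun i => (i <= n%:Z) && (n%:Z + 1 <= w i))].

(* The mirrored extension of the images f 1, ..., f n of 1, ..., n. *)
Definition mirror_ext (n : nat) (f : nat -> int) (e : int) : int :=
  let m := (e %/ NN n)%Z in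
  let r := `|(e %% NN n)%Z|%N in
  if r == 0%N then e
  else if (r <= n)%N then f r + m * NN n
  else NN n - f (n.*2.+1 - r)%N + m * NN n.

Definition gen_images (t : affine_type) (n k i : nat) : int :=
  if k == 0%N then
    if left_fork t then
      if i == 1%N then - 2%:Z else if i == 2%N then - 1%:Z else i%:Z
    else if i == 1%N then - 1%:Z else i%:Z
  else if k == n then
    if right_fork t then
      if i == n.-1 then n.+1%:Z else if i == n then n.+2%:Z else i%:Z
    else if i == n then n.+1%:Z else i%:Z
  else if i == k then k.+1%:Z else if i == k.+1 then k%:Z else i%:Z.

Definition gen (t : affine_type) (n k : nat) : int -> int :=
  mirror_ext n (gen_images t n k).

Definition word_prod (t : affine_type) (n : nat) (s : seq nat) : int -> int :=
  foldr (fun k f => gen t n k \o f) id s.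

Definition is_word (t : affine_type) (n : nat) (s : seq nat) (w : int -> int) :
    Prop :=
  all (fun k => k <= n)%N s /\ word_prod t n s =1 w.

Definition has_length (t : affine_type) (n : nat) (w : int -> int) (l : nat) :
    Prop :=
  (exists2 s, is_word t n s w & size s = l) /\
  (forall s, is_word t n s w -> (l <= size s)%N).

(* The finite parabolic subgroup W = <s_1, ..., s_n>. *)
Definition in_parabolic (t : affine_type) (n : nat) (v : int -> int) : Prop :=
  exists2 s, all (fun k => 0 < k <= n)%N s & word_prod t n s =1 v.

Definition min_coset_rep (t : affine_type) (n : nat) (w : int -> int) : Prop :=
  in_group t n w /\
  exists2 l, has_length t n w l
    & forall v l', in_parabolic t n v -> has_length t n (w \o v) l' ->
        (l <= l')%N.

(** * Abaci and cores *)

(* An abacus is given by its set of beads. *)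
Definition abacus (n : nat) (w : int -> int) : pred int := fun e =>
  ~~ (NN n %| e)%Z &&
  has (fun i : nat => (e == w i%:Z %[mod NN n])%Z && (e <= w i%:Z))
      (iota 1 n.*2).

Definition gap (n : nat) (a : pred int) : pred int := fun e =>
  ~~ (NN n %| e)%Z && ~~ a e.

Definition gaps_between (n : nat) (a : pred int) (lo hi : int) : nat :=
  count (gap n a) [seq lo + k%:Z | k <- iota 1 (absz (hi - lo - 1)%R)].

(* All entries smaller than - radius n w are beads and all those larger than
   radius n w are gaps: see abacus_low and abacus_high below. *)
Definition radius (n : nat) (w : int -> int) : nat :=
  \sum_(1 <= i < n.*2.+1) `|w i%:Z|%N.

Definition beads_desc (n : nat) (w : int -> int) : seq int :=
  [seq e <- [seq (radius n w)%:Z - k%:Z | k <- iota 0 (radius n w).*2.+1]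
  | abacus n w e].

(* A north-step of the boundary path ends the row whose length is the number of
   east-steps before it; a later north-step belongs to a higher row. *)
Definition core (n : nat) (w : int -> int) : seq nat :=
  [seq m <- [seq gaps_between n (abacus n w) (- (radius n w)%:Z - 1) b
            | b <- beads_desc n w]
  | (0 < m)%N].

Definition gen_acts (t : affine_type) (n k : nat) (lam mu : seq nat) : Prop :=
  exists w u v : int -> int,
    [/\ min_coset_rep t n w, min_coset_rep t n u, in_parabolic t n v,
        u =1 gen t n k \o w \o v & lam = core n w /\ mu = core n u].

(** * Residues *)

(* (row, column), both counted from 1 *)
Definition box := (nat * nat)%type.

Definition row_len (lam : seq nat) (i : nat) : nat := nth 0%N lam i.-1.

Definition col_len (lam : seq nat) (j : nat) : nat :=
  count (fun m => j <= m)%N lam.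

Definition diag (c : box) : int := c.2%:Z - c.1%:Z.

Definition diag_mod (n : nat) (c : box) : nat :=
  `|(diag c %% (n.*2)%:Z)%Z|%N.

Definition fixed_residue (n : nat) (c : box) : nat :=
  if (diag_mod n c <= n)%N then diag_mod n c else (n.*2 - diag_mod n c)%N.

(* The residues of c_1, c_2, c_3 when the row ends in c_p (immediately left of
   c_1 if p = 0); the empty list means undefined. *)
Definition stair_residues (x y : nat) (p : int) : seq (seq nat) :=
  match p with
  | Posz 0 => [:: [:: x; y]; [:: y]; [::]]
  | Posz 1 => [:: [:: x]; [:: y]; [:: y]]
  | Posz 2 => [:: [:: y]; [:: y]; [:: x]]
  | Posz 3 => [:: [::]; [:: y]; [:: x; y]]
  | _ => [:: [::]; [::]; [::]]
  end.

(* The components of the cells considered consist of three consecutive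
   diagonals; q in {0, 1, 2} is the position of the diagonal of c among them, by
   increasing j - i. A row of an upper component meets them in this order, a
   column of a lower one (read downwards) in the opposite order. *)
Definition stair_residue (x y q : nat) (lam : seq nat) (c : box) : seq nat :=
  if (c.1 < c.2)%N then
    nth [::] (stair_residues x y
                ((row_len lam c.1)%:Z - c.2%:Z + q%:Z + 1)) q
  else
    nth [::] (stair_residues x y
                ((col_len lam c.2)%:Z - c.1%:Z + (2 - q)%N%:Z + 1)) (2 - q)%N.

Definition main_descalator_residue (c : box) : nat :=
  if c.1 == c.2 then 0%N
  else if (c.1 + c.2 == 1 %[mod 4])%N then 1%N else 0%N.

Definition residues (t : affine_type) (n : nat) (lam : seq nat) (c : box) :
    seq nat :=
  let d := diag_mod n c in
  if left_fork t && (d \in [:: 0; 1; n.*2.-1]%N) then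
    if (`|diag c|%N <= 1)%N then [:: main_descalator_residue c]
    else stair_residue 1 0 (d.+1 %% n.*2)%N lam c
  else if right_fork t && (d \in [:: n.-1; n; n.+1]) then
    stair_residue n.-1 n (d.+1 - n)%N lam c
  else [:: fixed_residue n c].

(** * Central peeling *)

Definition ref_diag (t : affine_type) : nat :=
  match t with CC | BD => 0 | BB | DD => 1 end.

Definition ref_row (t : affine_type) (lam : seq nat) : nat :=
  count (fun i => i + ref_diag t <= row_len lam i)%N (iota 1 (size lam)).

Definition end_box (t : affine_type) (lam : seq nat) : box :=
  (ref_row t lam, row_len lam (ref_row t lam)).

Definition peel_residue (t : affine_type) (n : nat) (lam : seq nat) (r : nat) :
    Prop :=
  let R := residues t n lam (end_box t lam) in
  if (n \in R) && (n.-1 \in R) then r = n else r \in R.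

Definition removed_box (t : affine_type) (lam mu : seq nat) (c : box) : bool :=
  let d := ref_row t lam in
  (c.1 == d) && (row_len mu d < c.2 <= row_len lam d)%N.

Definition recorded (t : affine_type) (n r : nat) (lam mu : seq nat) (c : box) :
    bool :=
  if right_fork t && (r == n) then
    removed_box t lam mu c && (diag c != n%:Z)
  else if left_fork t && (r == 0%N) then
    removed_box t lam mu c && (diag c != 0) && (diag c != (n.*2)%:Z)
  else c == end_box t lam.

(* peeling t n lam U: the procedure started at lam terminates and U lists the
   boxes of the upper diagram with their residues, in the order in which they
   are recorded. *)
Inductive peeling (t : affine_type) (n : nat) :
    seq nat -> seq (box * nat) -> Prop :=
| Peeling_nil : peeling t n [::] [::]
| Peeling_step (lam mu : seq nat) (r : nat) (c : box) (U : seq (box * nat)) :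
    lam <> [::] -> peel_residue t n lam r -> gen_acts t n r lam mu ->
    recorded t n r lam mu c -> peeling t n mu U ->
    peeling t n lam ((c, r) :: U).

(** * Bounded partitions *)

Definition row_cols (U : seq (box * nat)) (i : nat) : seq nat :=
  undup [seq x.1.2 | x <- U & x.1.1 == i].

Definition row_count (U : seq (box * nat)) (i : nat) : nat :=
  size (row_cols U i).

Definition diagram_rows (U : seq (box * nat)) : seq nat :=
  iota 1 (\max_(x <- U) x.1.1)%N.

Definition star_size (t : affine_type) (n : nat) : nat :=
  match t with DD => n.-1 | _ => n end.

Definition starred (t : affine_type) (n : nat) (U : seq (box * nat)) (i : nat) :
    bool :=
  [&& right_fork t, row_count U i == star_size t n,
      all (fun j => (i < j)%N ==> (row_count U j != star_size t n))
          (diagram_rows U)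
    & ((i, (\max_(j <- row_cols U i) j)%N), n.-1) \in U].

(* Parts are paired with a boolean telling whether they are starred. *)
Definition diagram_parts (t : affine_type) (n : nat) (U : seq (box * nat)) :
    seq (nat * bool) :=
  [seq p <- [seq (row_count U i, starred t n U i) | i <- diagram_rows U]
  | (0 < p.1)%N].

Definition bounded_partition (t : affine_type) (n : nat) (w : int -> int)
    (beta : seq (nat * bool)) : Prop :=
  exists2 U, peeling t n (core n w) U & beta = diagram_parts t n U.

Definition bead_part (t : affine_type) (n : nat) (a : pred int) (b : int) :
    int * bool :=
  if NN n + n%:Z < b then
    ((gaps_between n a (b - NN n) b)%:Z + 1 + x0 t + xn t, false)
  else (b - NN n + x0 t, right_fork t && (b == NN n + n%:Z)).

(* As in any partition, zero parts are disregarded. *)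
Definition abacus_parts (t : affine_type) (n : nat) (w : int -> int) :
    seq (int * bool) :=
  [seq p <- [seq bead_part t n (abacus n w) b
            | b <- beads_desc n w & NN n < b]
  | p.1 != 0].

(** * The radius bounds the abacus *)

Lemma le_radius (n : nat) (w : int -> int) (i : nat) :
  (0 < i <= n.*2)%N -> (`|w i%:Z| <= radius n w)%N.
Proof.
move=> /andP[i0 iN]; rewrite /radius (bigD1_seq i) ?iota_uniq //=.
  exact: leq_addr.
by rewrite mem_index_iota i0.
Qed.

Lemma abacus_high (n : nat) (w : int -> int) (e : int) :
  (radius n w)%:Z < e -> ~~ abacus n w e.
Proof.
move=> he; apply/negP => /andP[_ /hasP[i]]; rewrite mem_iota => hi /andP[_].
have /(@le_radius n w) : (0 < i <= n.*2)%N by lia.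
lia.
Qed.

Lemma mirrored_shift (n : nat) (w : int -> int) (m i : int) :
  mirrored n w -> w (i + m * NN n) = w i + m * NN n.
Proof.
case=> _ wN _.
have wNn (k : nat) j : w (j + k%:Z * NN n) = w j + k%:Z * NN n.
  elim: k j => [|k IH] j; first by rewrite mul0r !addr0.
  have -> : k.+1%:Z * NN n = NN n + k%:Z * NN n.
    by rewrite -addn1 PoszD mulrDl mul1r addrC.
  by rewrite addrA IH wN addrA.
case: m => k; first exact: wNn.
rewrite NegzE mulNr -{2}(subrK (k.+1%:Z * NN n) i) wNn addrK.
by [].
Qed.

Lemma abacus_low (n : nat) (w : int -> int) (e : int) :
  mirrored n w -> ~~ (NN n %| e)%Z -> e < - (radius n w)%:Z -> abacus n w e.
Proof.
move=> mw he hlt; rewrite /abacus he /=; apply/hasP.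
have [[g _ gK] _ w_odd] := mw.
pose j := g e; have wj : w j = e by exact: gK.
have N0 : NN n != 0 by [].
have Ngt0 : 0 < NN n by [].
have w0 : w 0 = 0 by move: (w_odd 0); rewrite oppr0; move: (w 0) => z; lia.
pose m := (j %/ NN n)%Z; pose r := (j %% NN n)%Z.
have jE : j = r + m * NN n by rewrite addrC; exact: divz_eq.
have wE : e = w r + m * NN n by rewrite -wj jE mirrored_shift.
have r_ge0 : 0 <= r by exact: modz_ge0.
have r_lt : r < NN n by exact: ltz_pmod.
have r_neq0 : r != 0.
  apply: contra he => /eqP r0.
  by rewrite wE r0 w0 add0r; apply/dvdzP; exists m.
have rE : r = `|r|%N%:Z by lia.
have ir : (0 < `|r| <= n.*2)%N by move: r_lt; rewrite /NN; lia.
exists `|r|%N; first by rewrite mem_iota; lia.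
rewrite -rE; apply/andP; split.
  by rewrite wE addrC modzMDl.
by have := le_radius w ir; rewrite -rE; lia.
Qed.

(* Main.v *)
(* Since an entry e is a bead of the abacus of w exactly when w^-1(e) < N, applying
   s_k permutes the beads by s_k. The i-th largest bead b ends row i of the core and
   the content of the last box of that row is the number of entries between N and
   b. Hence central peeling acts on b, the smallest bead above N (above N + 1 when
   the reference diagonal is the first one), and the residue r_i is the one for
   which s_{r_i} lowers b. It suffices to see that such a step decreases the part
   of b by one and leaves the other parts unchanged. For a bead b' > N + n, the
   number of gaps between b' and b' - N is the number of runners whose largest bead
   is less than b' - N; it is unchanged because s_{r_i} inverts no pair of beads
   above b - N. The part of b itself is explicit because there are no other beads
   between N + 1 and b. Stars appear or disappear only when s_n^D brings a bead
   from N + n + 2 to N + n, in which case row d also has the size of a starred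
   part or is one box longer. *)

Require Import Defs.
From mathcomp Require Import all_boot all_order all_algebra.
From mathcomp Require Import zify.
From Stdlib Require Import Classical.

Set Implicit Arguments.
Unset Strict Implicit.
Unset Printing Implicit Defensive.

Import Order.TTheory GRing.Theory Num.Theory.
Local Open Scope ring_scope.

(** [bounded_partition] is a relation, so the equivalence asks for two things: every terminating
    peeling yields the predicted parts, and some peeling does terminate. Minimal length
    representatives and cores enter only through the abacus: it is constant on the cosets wW and is
    determined by the core. A step can therefore be followed on [abacus n w], whichever
    representatives [gen_acts] chooses. The explicit counts come from one symmetry: w(-i) = -w(i)
    and periodicity make e -> 2N - e exchange beads and gaps. This centres the contents at N and
    places exactly n runner tops at or below n. In the main descalator the residue is decided by the
    parity of the row, whereas the choice between s_0^D and s_1 has to depend on whether N + 1 is a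
    bead. The parity condition that defines the group reconciles the two. The induction runs
    backwards from the empty core and adds one box at a time to a diagram already described; a new
    box lies to the right of those already in its row, so no box is counted twice. *)

(** * Generators *)

(* Every generator raises the entries with residue in low_residues by shift and
   lowers their images back; see gen_spec. *)
Definition shift (t : affine_type) (n k : nat) : int :=
  if k == 0%N then if left_fork t then 3 else 2
  else if (k == n) && right_fork t then 2 else 1.

Definition low_residues (t : affine_type) (n k : nat) : seq int :=
  if k == 0%N then if left_fork t then [:: NN n - 2; NN n - 1] else [:: NN n - 1]
  else if (k == n) && right_fork t then [:: n%:Z - 1; n%:Z]
  else [:: k%:Z; NN n - k%:Z - 1].

Definition low (t : affine_type) (n k : nat) (e : int) : bool :=
  (e %% NN n)%Z \in low_residues t n k.

Lemma NN_gt0 (n : nat) : 0 < NN n. Proof. by []. Qed.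

Lemma NNE (n : nat) : NN n = n%:Z + n%:Z + 1. Proof. rewrite /NN; lia. Qed.

Lemma modz_subC (N e d : int) : 0 < N -> 0 <= d <= N ->
  ((e - d) %% N)%Z =
  if d <= (e %% N)%Z then (e %% N)%Z - d else (e %% N)%Z - d + N.
Proof.
move=> N0 dN; have r0 : 0 <= (e %% N)%Z by apply: modz_ge0; lia.
have rN : (e %% N)%Z < N by apply: ltz_pmod.
rewrite -modzDml; set r := (e %% N)%Z in r0 rN *.
case: ifP => h; first by rewrite modz_small //; lia.
by rewrite -(modzDr (r - d)) modz_small //; lia.
Qed.

Lemma rank_bound t n : (min_rank t <= n)%N ->
  (2 <= n)%N /\ (left_fork t || right_fork t -> (3 <= n)%N) /\
  (left_fork t && right_fork t -> (4 <= n)%N).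
Proof. by case: t => /= ?; lia. Qed.

Lemma residue_bounds n e : 0 <= (e %% NN n)%Z < NN n.
Proof. by rewrite modz_ge0 //= ltz_pmod. Qed.

Lemma shift_bounds t n k : 0 < shift t n k <= 3.
Proof. by rewrite /shift; repeat case: ifP. Qed.

Lemma low_caseP t n k : (min_rank t <= n)%N -> (k <= n)%N ->
  [\/ [/\ k = 0%N, left_fork t, (3 <= n)%N, shift t n k = 3 &
         low_residues t n k = [:: NN n - 2; NN n - 1]],
      [/\ k = 0%N, ~~ left_fork t, (2 <= n)%N, shift t n k = 2 &
         low_residues t n k = [:: NN n - 1]],
      [/\ k = n, right_fork t, (3 <= n)%N, shift t n k = 2 &
         low_residues t n k = [:: n%:Z - 1; n%:Z]] |
      [/\ (0 < k)%N && ((k < n)%N || ~~ right_fork t), (2 <= n)%N, (k <= n)%N,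
          shift t n k = 1 &
         low_residues t n k = [:: k%:Z; NN n - k%:Z - 1]]].
Proof.
move=> /rank_bound[n2 [n3 _]] kn; rewrite /shift /low_residues.
have [k0|k0] := eqVneq k 0%N.
  case hl: (left_fork t) n3 => /= n3; first by constructor 1; rewrite n3.
  by constructor 2.
have [kn'|kn'] := eqVneq k n; case hr: (right_fork t) n3 => /= n3.
- by constructor 3; rewrite n3 // orbT.
- by constructor 4; split=> //; lia.
- by constructor 4; split=> //; lia.
- by constructor 4; split=> //; lia.
Qed.

Lemma gen_spec t n k e : (min_rank t <= n)%N -> (k <= n)%N ->
  gen t n k e = if low t n k e then e + shift t n k
                else if low t n k (e - shift t n k) then e - shift t n k else e.
Proof.
move=> hn hk; have n2 := (rank_bound hn).1.
rewrite /low modz_subC ?NN_gt0 //; last first.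
  by have := shift_bounds t n k; rewrite NNE; lia.
have /andP[r0 rN] := residue_bounds n e.
rewrite /gen /mirror_ext.
have := divz_eq e (NN n).
move: (e %% NN n)%Z r0 rN => r r0 rN eE.
set q := (_ * _)%R in eE *.
have N3 := NNE n.
have [j jE] : exists j : nat, r = j%:Z by exists `|r|%N; lia.
rewrite jE in r0 rN eE *; rewrite absz_nat /gen_images.
clear jE r.
case: (low_caseP hn hk) =>
  [[k0 lf n3 -> ->]|[k0 lf _ -> ->]|[kn rf n3 -> ->]|[hk0 _ _ -> ->]].
- rewrite k0 eqxx lf N3 !inE; rewrite N3 in rN; do !case: ifP; lia.
- rewrite k0 eqxx (negbTE lf) N3 !inE; rewrite N3 in rN; do !case: ifP; lia.
- have -> : k == 0%N = false by lia.
  rewrite kn eqxx rf N3 !inE; rewrite N3 in rN; do !case: ifP; lia.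
have -> : k == 0%N = false by lia.
rewrite N3 !inE; rewrite N3 in rN.
case: (eqVneq k n) hk0 => [->|kn] hk0; last by do !case: ifP; lia.
have -> : right_fork t = false by lia.
do !case: ifP; lia.
Qed.

Lemma low_shift t n k e : low t n k (e + NN n) = low t n k e.
Proof. by rewrite /low modzDr. Qed.

(** The pairs exchanged by s_k are stable under e -> -e, which swaps the lower and the upper end of
    a pair. *)
Lemma low_opp t n k e : (min_rank t <= n)%N -> (k <= n)%N ->
  low t n k (- e) = low t n k (e - shift t n k).
Proof.
move=> hn hk; have n2 := (rank_bound hn).1.
rewrite /low modz_subC ?NN_gt0 //; last first.
  by have := shift_bounds t n k; rewrite NNE; lia.
have rb := residue_bounds n e.
have -> : (- e %% NN n)%Z = if (e %% NN n)%Z == 0 then 0 else NN n - (e %% NN n)%Z.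
  have eE := divz_eq e (NN n); move: rb eE.
  move: (e %% NN n)%Z (e %/ NN n)%Z => r q rb eE.
  rewrite -(modzMDl (q + 1)) [X in (X %% _)%Z](_ : _ = NN n - r); last first.
    by rewrite eE mulrDl mul1r; lia.
  by case: eqP => [->|r0]; rewrite ?subr0 ?modzz ?modz_small //; lia.
move: (e %% NN n)%Z rb => r.
case: (low_caseP hn hk) =>
  [[k0 lf n3 -> ->]|[k0 lf _ -> ->]|[kn rf n3 -> ->]|[hk0 _ _ -> ->]];
  rewrite NNE !inE => rb; do !case: ifP; lia.
Qed.

Lemma low_sub_shift t n k e : (min_rank t <= n)%N -> (k <= n)%N ->
  low t n k e -> low t n k (e - shift t n k) = false.
Proof.
move=> hn hk; have n2 := (rank_bound hn).1.
rewrite /low modz_subC ?NN_gt0 //; last first.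
  by have := shift_bounds t n k; rewrite NNE; lia.
have := residue_bounds n e; move: (e %% NN n)%Z => r.
case: (low_caseP hn hk) =>
  [[k0 lf n3 -> ->]|[k0 lf _ -> ->]|[kn rf n3 -> ->]|[hk0 _ _ -> ->]];
  rewrite NNE !inE => rb; do !case: ifP; lia.
Qed.

Lemma low_not_dvd t n k e : (min_rank t <= n)%N -> (k <= n)%N ->
  low t n k e -> ~~ (NN n %| e)%Z && ~~ (NN n %| e + shift t n k)%Z.
Proof.
move=> hn hk; have n2 := (rank_bound hn).1.
have [e' eE] : exists e', e = e' - shift t n k by exists (e + shift t n k); lia.
rewrite eE subrK.
have -> : (NN n %| e' - shift t n k)%Z = ((e' - shift t n k) %% NN n == 0)%Z.
  by apply/dvdz_mod0P/eqP.
have -> : (NN n %| e')%Z = (e' %% NN n == 0)%Z.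
  by apply/dvdz_mod0P/eqP.
rewrite /low modz_subC ?NN_gt0 //; last first.
  by have := shift_bounds t n k; rewrite NNE; lia.
have := residue_bounds n e'; move: (e' %% NN n)%Z => r.
case: (low_caseP hn hk) =>
  [[k0 lf n3 -> ->]|[k0 lf _ -> ->]|[kn rf n3 -> ->]|[hk0 _ _ -> ->]];
  rewrite NNE !inE => rb; do !case: ifP; lia.
Qed.

(** The exchanged pairs interleave: what lies strictly inside one of them is an end of another, or a
    multiple of N that s_0 jumps over. *)
Lemma low_between t n k l x : (min_rank t <= n)%N -> (k <= n)%N ->
  low t n k l -> l < x < l + shift t n k -> ~~ (NN n %| x)%Z ->
  low t n k x || low t n k (x - shift t n k).
Proof.
move=> hn hk hl hx.
have -> : (NN n %| x)%Z = (x %% NN n == 0)%Z by apply/dvdz_mod0P/eqP.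
have n2 := (rank_bound hn).1; have sb := shift_bounds t n k.
have [j [jE jb]] : exists j, l = x - j /\ 0 < j < shift t n k.
  by exists (x - l); lia.
rewrite jE /low in hl *.
rewrite !modz_subC ?NN_gt0 // in hl *; try by (rewrite NNE; lia).
have := residue_bounds n x; move: (x %% NN n)%Z hl => r.
case: (low_caseP hn hk) jb =>
  [[k0 lf n3 -> ->]|[k0 lf _ -> ->]|[kn rf n3 -> ->]|[hk0 _ _ -> ->]];
  rewrite NNE !inE => jb; do !case: ifP; lia.
Qed.

Variant gen_cases t n k e : bool -> bool -> int -> Prop :=
| GenUp of low t n k e : gen_cases t n k e true false (e + shift t n k)
| GenDown of low t n k (e - shift t n k) :
    gen_cases t n k e false true (e - shift t n k)
| GenFix of ~~ low t n k e & ~~ low t n k (e - shift t n k) :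
    gen_cases t n k e false false e.

Lemma genP t n k e : (min_rank t <= n)%N -> (k <= n)%N ->
  gen_cases t n k e (low t n k e) (low t n k (e - shift t n k)) (gen t n k e).
Proof.
move=> hn hk; rewrite gen_spec //.
case hl: (low t n k e); first by rewrite low_sub_shift //; constructor.
by case hd: (low t n k _); constructor; rewrite ?hl ?hd.
Qed.

Lemma genK t n k : (min_rank t <= n)%N -> (k <= n)%N ->
  involutive (gen t n k).
Proof.
move=> hn hk e; case: (genP e hn hk) => [h|h|h1 h2].
- rewrite gen_spec // addrK h; case: ifP => // h'.
  by have := low_sub_shift hn hk h'; rewrite addrK h.
- by rewrite gen_spec // h subrK.
- by rewrite gen_spec // (negbTE h1) (negbTE h2).
Qed.

Lemma gen_addN t n k e : (min_rank t <= n)%N -> (k <= n)%N ->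
  gen t n k (e + NN n) = gen t n k e + NN n.
Proof.
move=> hn hk; rewrite !gen_spec // low_shift [e + NN n - _]addrAC low_shift.
by case: ifP => _; [|case: ifP => _]; rewrite // addrAC.
Qed.

Lemma gen_subN t n k e : (min_rank t <= n)%N -> (k <= n)%N ->
  gen t n k (e - NN n) = gen t n k e - NN n.
Proof. by move=> hn hk; rewrite -{2}(subrK (NN n) e) gen_addN // addrK. Qed.

Lemma gen_opp t n k e : (min_rank t <= n)%N -> (k <= n)%N ->
  gen t n k (- e) = - gen t n k e.
Proof.
move=> hn hk; rewrite !gen_spec // low_opp //.
rewrite -opprD (low_opp (e + shift t n k)) // addrK.
case h: (low _ _ _ e); first by rewrite low_sub_shift.
by case: ifP => // _; rewrite opprB addrC.
Qed.

Lemma gen_mirrored t n k : (min_rank t <= n)%N -> (k <= n)%N ->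
  mirrored n (gen t n k).
Proof.
move=> hn hk; split=> [|e|e]; last exact: gen_opp; last exact: gen_addN.
by exists (gen t n k); exact: genK.
Qed.

Lemma dvd_gen t n k e : (min_rank t <= n)%N -> (k <= n)%N ->
  (NN n %| gen t n k e)%Z = (NN n %| e)%Z.
Proof.
move=> hn hk; case: (genP e hn hk) => // h; have := low_not_dvd hn hk h.
  by case/andP=> /negbTE-> /negbTE->.
by rewrite subrK => /andP[/negbTE-> /negbTE->].
Qed.

(** If x is lowered, f goes down no further than x does. If x is fixed, f must be lowered past it,
    and x lies inside an exchanged pair, against [low_between]. So x is raised. *)
Lemma gen_inversion t n k x f : (min_rank t <= n)%N -> (k <= n)%N ->
  ~~ (NN n %| x)%Z -> x < f -> gen t n k f < gen t n k x -> low t n k x.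
Proof.
move=> hn hk nx xf.
have [//|hx|hx hx'] := genP x hn hk; have [hf|hf|hf hf'] := genP f hn hk;
  try by have := shift_bounds t n k; lia.
move=> fx; have := low_between (l := f - shift t n k) (x := x) hn hk hf.
by rewrite (negbTE hx) (negbTE hx') subrK fx xf nx => /(_ isT isT).
Qed.

(** Only s_0 exchanges entries on both sides of a multiple of N. Hence s_1, ..., s_n respect the
    first parity condition and the set of entries below N. *)
Lemma low_residue_pos t n k e : (min_rank t <= n)%N -> (0 < k <= n)%N ->
  low t n k e -> 0 < (e %% NN n)%Z /\ (e %% NN n)%Z + shift t n k < NN n.
Proof.
move=> hn /andP[k0 hk]; rewrite /low; move: (e %% NN n)%Z => r; rewrite NNE.
case: (low_caseP hn hk) =>
  [[k0' lf n3 -> ->]|[k0' lf _ -> ->]|[kn rf n3 -> ->]|[hk0 _ _ -> ->]];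
  rewrite !inE ?NNE; lia.
Qed.

(** Likewise, only s_n crosses the midpoints n + 1/2 modulo N, so the second parity condition is at
    stake for it alone. *)
Lemma low_residue_half t n k e : (min_rank t <= n)%N -> (k < n)%N ->
  low t n k e -> (e %% NN n)%Z + shift t n k <= n \/
  n%:Z < (e %% NN n)%Z /\ (e %% NN n)%Z + shift t n k <= NN n + n%:Z.
Proof.
move=> hn hk; rewrite /low; move: (e %% NN n)%Z => r; rewrite NNE.
case: (low_caseP hn (ltnW hk)) =>
  [[k0' lf n3 -> ->]|[k0' lf _ -> ->]|[kn rf n3 -> ->]|[hk0 _ _ -> ->]];
  rewrite !inE ?NNE; lia.
Qed.

(** Replacing the multiple of N by a variable with linear bounds brings the later case distinctions
    within reach of [lia]. *)
Lemma divz_split n e : exists z, e = z + (e %% NN n)%Z /\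
  (z <= - NN n \/ z = 0 \/ NN n <= z).
Proof.
exists ((e %/ NN n)%Z * NN n); split; first exact: divz_eq.
have := NN_gt0 n; move: (e %/ NN n)%Z => q; move: (NN n) => N N0.
have [->|q0] := eqVneq q 0; first by right; left; lia.
have [qp|qn] := leP 1 q; [right; right|left]; nia.
Qed.

Lemma gen_pos t n k e : (min_rank t <= n)%N -> (0 < k <= n)%N ->
  (0 < gen t n k e) = (0 < e).
Proof.
move=> hn hk; have hk' : (k <= n)%N by lia.
have lowP x : low t n k x -> (0 < x + shift t n k) = (0 < x).
  move=> /(low_residue_pos hn hk).
  have [z [xE zE]] := divz_split n x; have := residue_bounds n x.
  have := shift_bounds t n k; move: xE.
  move: (x %% NN n)%Z (NN n) (NNE n) zE => r N ->; lia.
by case: (genP e hn hk') => // h; rewrite -?(lowP _ h) ?subrK ?lowP.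
Qed.

Lemma gen_lt_period t n k e : (min_rank t <= n)%N -> (0 < k <= n)%N ->
  (gen t n k e < NN n) = (e < NN n).
Proof.
move=> hn hk; have hk' : (k <= n)%N by lia.
have -> : (gen t n k e < NN n) = (0 < gen t n k (NN n - e)).
  by rewrite addrC gen_addN // gen_opp //; lia.
by rewrite gen_pos //; lia.
Qed.

Lemma gen_half t n k e : (min_rank t <= n)%N -> (k < n)%N ->
  (n%:Z + 1 <= gen t n k e) = (n%:Z + 1 <= e).
Proof.
move=> hn hk.
have lowP x : low t n k x -> (n%:Z + 1 <= x + shift t n k) = (n%:Z + 1 <= x).
  move=> /(low_residue_half hn hk).
  have [z [xE zE]] := divz_split n x; have := residue_bounds n x.
  have := shift_bounds t n k; move: xE.
  move: (x %% NN n)%Z (NN n) (NNE n) zE => r N ->; lia.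
by case: (genP e hn (ltnW hk)) => // h; rewrite -?(lowP _ h) ?subrK ?lowP.
Qed.

Lemma gen0_pos t n e : (min_rank t <= n)%N -> left_fork t ->
  (1 <= gen t n 0 e) = (1 <= e) (+) (e \in [:: 1; -1; 2; -2]).
Proof.
move=> hn lf; rewrite gen_spec // /low modz_subC //; last first.
  by have := shift_bounds t n 0; have := rank_bound hn; rewrite NNE; lia.
rewrite /low_residues /shift /= lf.
have [z [xE zE]] := divz_split n e; have := residue_bounds n e.
have n3 := (rank_bound hn).2.1; rewrite lf in n3; have {}n3 := n3 isT.
move: xE; move: (e %% NN n)%Z (NN n) (NNE n) zE => r N ->; rewrite !inE.
move=> zE xE rb; do !case: ifP; lia.
Qed.

Lemma genn_half t n e : (min_rank t <= n)%N -> right_fork t ->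
  (n%:Z + 1 <= gen t n n e) =
  (n%:Z + 1 <= e) (+)
  (e \in [:: n%:Z + 1; NN n - (n%:Z + 1); n%:Z + 2; NN n - (n%:Z + 2)]).
Proof.
move=> hn rf; rewrite gen_spec // /low modz_subC //; last first.
  by have := shift_bounds t n n; have := rank_bound hn; rewrite NNE; lia.
have n3 := (rank_bound hn).2.1; rewrite rf orbT in n3; have {}n3 := n3 isT.
have n0 : n == 0%N = false by lia.
rewrite /low_residues /shift /= n0 eqxx rf /=.
have [z [xE zE]] := divz_split n e; have := residue_bounds n e.
move: xE; move: (e %% NN n)%Z (NN n) (NNE n) zE => r N ->; rewrite !inE.
move=> zE xE rb; do !case: ifP; lia.
Qed.

(** * Parity conditions and coset representatives *)

Lemma toggle_seq (s : seq int) (p : int) : uniq s ->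
  exists s', [/\ uniq s', forall i, (i \in s') = (i \in s) (+) (i == p)
               & odd (size s') = ~~ odd (size s)].
Proof.
move=> us; have [ps|ps] := boolP (p \in s).
  exists (rem p s); split=> [|i|]; first exact: rem_uniq.
    by rewrite mem_rem_uniq // !inE; case: eqP => [->|_]; rewrite ?ps //= addbF.
  by rewrite size_rem //; case: (s) ps => //= a l _; rewrite negbK.
exists (p :: s); split=> [|i|//]; first by rewrite /= ps.
by rewrite inE; case: eqP => [->|_]; rewrite ?(negbTE ps) //= addbF.
Qed.

Lemma even_card_toggle (P P' : pred int) (p q : int) : p != q ->
  (forall i, P' i = P i (+) ((i == p) || (i == q))) ->
  even_card P -> even_card P'.
Proof.
move=> pq hP' [s [us sP so]].
have [s1 [us1 s1P s1o]] := toggle_seq p us.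
have [s2 [us2 s2P s2o]] := toggle_seq q us1.
exists s2; split=> [//|i|]; last by rewrite s2o s1o negbK.
rewrite s2P s1P sP hP' -addbA; congr (_ (+) _).
by case: eqP => [->|_]; rewrite ?(negbTE pq) //=.
Qed.

Lemma even_card_ext (P P' : pred int) : P =1 P' -> even_card P -> even_card P'.
Proof.
by move=> PP [s [us sP so]]; exists s; split=> // i; rewrite sP PP.
Qed.

Lemma mirrored_comp n w v : mirrored n w -> mirrored n v -> mirrored n (w \o v).
Proof.
move=> [bw wN wo] [bv vN vo]; split=> [|i|i] /=; first exact: bij_comp.
  by rewrite vN wN.
by rewrite vo wo.
Qed.

Lemma mirrored_ext n w v : w =1 v -> mirrored n w -> mirrored n v.
Proof.
move=> wv [bw wN wo]; split=> [|i|i]; first exact: eq_bij bw _ wv.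
  by rewrite -!wv wN.
by rewrite -!wv wo.
Qed.

Lemma mirrored_inv n w : mirrored n w ->
  exists g, [/\ cancel w g, cancel g w, forall e : int, g (e + NN n) = g e + NN n
              & forall e : int, g (- e) = - g e].
Proof.
move=> [[g wK gK] wN wo]; exists g; split=> // e; apply: (can_inj wK).
  by rewrite gK wN gK.
by rewrite gK wo gK.
Qed.

Lemma in_group_gen t n k w : (min_rank t <= n)%N -> (k <= n)%N ->
  in_group t n w -> in_group t n (gen t n k \o w).
Proof.
move=> hn hk [mw hl hr]; split.
- by apply: mirrored_comp => //; apply: gen_mirrored.
- move=> lf; have {}hl := hl lf.
  have [k0|k0] := posnP k; last first.
    by apply: even_card_ext hl => i /=; rewrite -!gtz0_ge1 gen_pos ?k0.
  have [g [wK gK gN go]] := mirrored_inv mw.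
  have gi := can_inj gK.
  (* The positions of 1 and -1 are opposite, so exactly one of them is some i <= 0, and s_0^D
     changes there whether w(i) >= 1; likewise for 2 and -2. *)
  apply: (even_card_toggle (p := - `|g 1|) (q := - `|g 2|)) hl.
    apply/eqP => h; have : g 1 = g 2 \/ g 1 = g (-2).
      by rewrite go; move: (g 1) (g 2) h => p q; lia.
    by case=> /gi.
  move=> i /=; rewrite k0 gen0_pos // !inE !(can2_eq wK gK) !go.
  by move: (g 1) (g 2) (1 <= w i) => p q [] ; lia.
move=> rf; have {}hr := hr rf.
have [kn|kn] := ltnP k n.
  by apply: even_card_ext hr => i /=; rewrite gen_half.
have {}kn : k = n by lia.
have [g [wK gK gN go]] := mirrored_inv mw.
have gi := can_inj gK.
(* The positions of i and N - i add up to N = 2n + 1, so exactly one of them is at most n. *)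
pose low i := if g i <= n%:Z then g i else NN n - g i.
have gC i : g (NN n - i) = NN n - g i by rewrite addrC gN go addrC.
apply: (even_card_toggle (p := low (n%:Z + 1)) (q := low (n%:Z + 2))) hr.
  apply/eqP => h.
  have : g (n%:Z + 1) = g (n%:Z + 2) \/ g (n%:Z + 1) = g (NN n - (n%:Z + 2)).
    rewrite gC; move: h; rewrite /low; move: (g _) (g _) => p q.
    by do 2!case: ifP; lia.
  by case=> /gi; have := NNE n; have := rank_bound hn; lia.
move=> i /=; rewrite kn genn_half // !inE !(can2_eq wK gK) !gC /low.
rewrite NNE; move: (g (n%:Z + 1)) (g (n%:Z + 2)) (_ <= w i) => p q [].
  by do 2!case: ifP; lia.
by do 2!case: ifP; lia.
Qed.

Lemma word_prod_cat t n s1 s2 :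
  word_prod t n (s1 ++ s2) =1 word_prod t n s1 \o word_prod t n s2.
Proof. by elim: s1 => //= k s1 IH i /=; rewrite IH. Qed.

Lemma in_group_ext t n w v : w =1 v -> in_group t n w -> in_group t n v.
Proof.
move=> wv [mw hl hr]; split; first exact: mirrored_ext mw.
  by move=> /hl; apply: even_card_ext => i /=; rewrite wv.
by move=> /hr; apply: even_card_ext => i /=; rewrite wv.
Qed.

Lemma in_group_word t n s : (min_rank t <= n)%N ->
  all (fun k => k <= n)%N s -> in_group t n (word_prod t n s).
Proof.
move=> hn; elim: s => [_|k s IH /= /andP[hk /IH]]; last exact: in_group_gen.
split=> //=; first by split=> //; exists id.
  by exists [::]; split=> // i; rewrite in_nil; lia.
by exists [::]; split=> // i; rewrite in_nil; lia.
Qed.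

Lemma in_parabolic_mirrored t n v : (min_rank t <= n)%N -> in_parabolic t n v ->
  mirrored n v /\ forall e, (v e < NN n) = (e < NN n).
Proof.
move=> hn [s hs sv]; split.
  apply: mirrored_ext sv _.
  have /(in_group_word hn)[//] : all (fun k => k <= n)%N s.
  by apply: sub_all hs => k /andP[].
move=> e; rewrite -sv; elim: s hs {v sv} => //= k s IH /andP[hk /IH <-].
by rewrite gen_lt_period.
Qed.

Lemma nat_min (P : nat -> Prop) : (exists m, P m) ->
  exists2 m, P m & forall k, P k -> (m <= k)%N.
Proof.
move=> [m Pm]; elim/ltn_ind: m Pm => m IH Pm.
have [[k [km Pk]]|h] := classic (exists k, (k < m)%N /\ P k); first exact: IH Pk.
exists m => // k Pk; rewrite leqNgt; apply/negP => km.
by apply: h; exists k.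
Qed.

Lemma has_length_ex t n w s : is_word t n s w -> exists l, has_length t n w l.
Proof.
move=> hs; have [] := @nat_min (fun m => exists2 s, is_word t n s w & size s = m).
  by exists (size s), s.
by move=> m h1 h2; exists m; split=> // s' hs'; apply: h2; exists s'.
Qed.

Lemma is_word_comp t n s1 s2 w v : is_word t n s1 w -> is_word t n s2 v ->
  is_word t n (s1 ++ s2) (w \o v).
Proof.
move=> [a1 e1] [a2 e2]; split; first by rewrite all_cat a1.
by move=> i; rewrite word_prod_cat /= e2 e1.
Qed.

Lemma in_parabolic_word t n v : in_parabolic t n v -> exists s, is_word t n s v.
Proof.
by move=> [s hs sv]; exists s; split=> //; apply: sub_all hs => k /andP[].
Qed.

Lemma in_parabolic_comp t n v v' : in_parabolic t n v -> in_parabolic t n v' ->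
  in_parabolic t n (v \o v').
Proof.
move=> [s hs sv] [s' hs' sv']; exists (s ++ s'); first by rewrite all_cat hs.
by move=> i; rewrite word_prod_cat /= sv' sv.
Qed.

(** The length of [w] comes with a word, so every element of the coset of s_k w has a word and a
    shortest one exists. Words also give membership in the group. *)
Lemma min_coset_rep_ex t n k w : (min_rank t <= n)%N -> (k <= n)%N ->
  min_coset_rep t n w ->
  exists u v, [/\ min_coset_rep t n u, in_parabolic t n v
                & u =1 gen t n k \o w \o v].
Proof.
move=> hn hk [gw [l [[ws hws _] _] _]].
pose kw := gen t n k \o w.
have hkw : is_word t n (k :: ws) kw.
  by split=> [|i /=]; [rewrite /= hk hws.1|rewrite hws.2].
have [|l' [v pv hl'] minl'] := @nat_min (fun m =>
    exists2 v, in_parabolic t n v & has_length t n (kw \o v) m).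
  have [m hm] := has_length_ex hkw; exists m, id => //.
  by exists [::].
exists (kw \o v), v; split=> //; split.
  have [sv hsv] := in_parabolic_word pv.
  have [h1 h2] := is_word_comp hkw hsv.
  exact: in_group_ext h2 (in_group_word hn h1).
exists l' => // v' l'' pv' hl''; apply: minl'; exists (v \o v') => //.
exact: in_parabolic_comp.
Qed.

(** * Abaci *)

Lemma mirrored_inv_addM n w g m e : mirrored n w -> cancel w g -> cancel g w ->
  g (e + m * NN n) = g e + m * NN n.
Proof.
by move=> mw wK gK; apply: (can_inj wK); rewrite mirrored_shift // !gK.
Qed.

Lemma mirrored_mul n w m : mirrored n w -> w (m * NN n) = m * NN n.
Proof.
move=> mw; have := mirrored_shift m 0 mw; rewrite !add0r => ->.
have [_ _ wo] := mw; suff -> : w 0 = 0 by rewrite add0r.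
by have := wo 0; rewrite oppr0; move: (w 0) => x; lia.
Qed.

Lemma dvd_mirrored n w e : mirrored n w -> (NN n %| w e)%Z = (NN n %| e)%Z.
Proof.
move=> mw; have [g [wK gK _ go]] := mirrored_inv mw.
have w0 m := mirrored_mul m mw.
apply/dvdzP/dvdzP => [[m em]|[m em]]; exists m; last by rewrite em w0.
by apply: (can_inj wK); rewrite em w0.
Qed.

Lemma abacusE n w g e : mirrored n w -> cancel w g -> cancel g w ->
  abacus n w e = ~~ (NN n %| e)%Z && (g e < NN n).
Proof.
move=> mw wK gK; rewrite /abacus; case hd: (NN n %| e)%Z => //=.
have gM := mirrored_inv_addM _ _ mw wK gK.
have N0 := NN_gt0 n.
apply/hasP/idP => [[i]|he].
  rewrite mem_iota => hi /andP[/eqP hm hle].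
  have [m em] : exists m, e = w i%:Z + m * NN n.
    exists ((e %/ NN n)%Z - (w i%:Z %/ NN n)%Z).
    by rewrite {1}(divz_eq e (NN n)) {1}(divz_eq (w i%:Z) (NN n)) hm mulrBl; lia.
  rewrite em gM wK; have m0 : m <= 0.
    by rewrite leNgt; apply/negP => m0; nia.
  have : m * NN n <= 0 by nia.
  by rewrite /NN in hi *; lia.
have := divz_eq (g e) (NN n); have := residue_bounds n (g e).
set r := (_ %% _)%Z; set q := (_ %/ _)%Z => rb ge.
have r0 : r != 0.
  apply: contraFN hd => /eqP r0; rewrite -(gK e) dvd_mirrored // ge r0 addr0.
  exact: dvdz_mull.
exists `|r|%N; first by rewrite mem_iota; move: rb; rewrite /NN; lia.
have -> : `|r|%N%:Z = r by lia.
have eE : e = w r + q * NN n by rewrite -mirrored_shift // addrC -ge gK.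
rewrite eE addrC modzMDl eqxx /=.
have q0 : q <= 0 by rewrite leNgt; apply/negP => q0; nia.
by nia.
Qed.

(** What the counting arguments use of an abacus. [good_mirror] is the reflection about N; the bound
    R is a parameter so that two abaci can be compared under a common one. *)
Record good (n : nat) (a : pred int) (R : nat) : Prop := Good {
  good_div : forall e, (NN n %| e)%Z -> a e = false;
  good_sub : forall e, a e -> a (e - NN n);
  good_mirror : forall e, ~~ (NN n %| e)%Z -> a (NN n + NN n - e) = ~~ a e;
  good_high : forall e, R%:Z < e -> a e = false;
  good_low : forall e, ~~ (NN n %| e)%Z -> e < - R%:Z -> a e }.

Lemma dvd_addN n e : (NN n %| e + NN n)%Z = (NN n %| e)%Z.
Proof. by rewrite !(sameP dvdz_mod0P eqP) modzDr. Qed.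

Lemma dvd_subN n e : (NN n %| e - NN n)%Z = (NN n %| e)%Z.
Proof. by rewrite -dvd_addN subrK. Qed.

Lemma dvd_mirror n e : (NN n %| NN n + NN n - e)%Z = (NN n %| e)%Z.
Proof.
by rewrite addrC addrA !dvd_addN; apply/dvdzP/dvdzP => -[q]; exists (- q); lia.
Qed.

Lemma abacus_good n w : mirrored n w -> good n (abacus n w) (radius n w).
Proof.
move=> mw; have [g [wK gK gN go]] := mirrored_inv mw.
have aE e := abacusE e mw wK gK.
have gB e : g (e - NN n) = g e - NN n.
  by apply: (can_inj wK); rewrite gK -{2}(subrK (NN n) e) gN addrK gK.
split=> [e he|e|e he|e he|e].
- by rewrite aE he.
- by rewrite !aE dvd_subN gB => /andP[-> /=]; have := NN_gt0 n; lia.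
- rewrite !aE dvd_mirror he /= addrC addrA !gN go.
  have : g e != NN n.
    by apply: contra he => /eqP ge; rewrite -(gK e) ge dvd_mirrored.
  by move: (g e) (NN n) => x N; lia.
- exact/negbTE/abacus_high.
- exact: abacus_low.
Qed.

Lemma abacus_ext n w v : w =1 v -> abacus n w =1 abacus n v.
Proof.
by move=> wv e; rewrite /abacus; congr (_ && _); apply: eq_has => i; rewrite wv.
Qed.

Lemma abacus_gen t n k w e : (min_rank t <= n)%N -> (k <= n)%N ->
  mirrored n w -> abacus n (gen t n k \o w) e = abacus n w (gen t n k e).
Proof.
move=> hn hk mw; have [g [wK gK _ _]] := mirrored_inv mw.
have mk := gen_mirrored hn hk; have kK := genK hn hk.
rewrite (abacusE _ mw wK gK) dvd_gen //.
rewrite (abacusE (g := g \o gen t n k) _ (mirrored_comp mk mw)) //= => i /=.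
  by rewrite kK wK.
by rewrite gK kK.
Qed.

Lemma abacus_parabolic t n w v : (min_rank t <= n)%N -> mirrored n w ->
  in_parabolic t n v -> abacus n (w \o v) =1 abacus n w.
Proof.
move=> hn mw pv e; have [mv vN] := in_parabolic_mirrored hn pv.
have [g [wK gK _ _]] := mirrored_inv mw; have [f [vK fK _ _]] := mirrored_inv mv.
rewrite (abacusE _ mw wK gK) (abacusE (g := f \o g) _ (mirrored_comp mw mv)) /=.
- by rewrite -vN fK.
- by move=> i /=; rewrite wK vK.
- by move=> i /=; rewrite fK gK.
Qed.

Definition rng (lo : int) (k : nat) : seq int := [seq lo + i%:Z | i <- iota 0 k].

Lemma mem_rng lo k e : (e \in rng lo k) = (lo <= e < lo + k%:Z).
Proof.
apply/mapP/idP => [[i]|h]; first by rewrite mem_iota => ? ->; lia.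
by exists `|e - lo|%N; rewrite ?mem_iota; lia.
Qed.

Lemma rng_uniq lo k : uniq (rng lo k).
Proof. by rewrite map_inj_uniq ?iota_uniq // => i j; lia. Qed.

Lemma rng_cat lo k1 k2 : rng lo (k1 + k2) = rng lo k1 ++ rng (lo + k1%:Z) k2.
Proof.
rewrite /rng iotaD map_cat; congr (_ ++ _).
by rewrite add0n -{1}[k1]addn0 iotaDl -map_comp; apply: eq_map => i /=; lia.
Qed.

Lemma rng_sorted lo k : sorted <%R (rng lo k).
Proof.
rewrite sorted_map; apply: sub_sorted (iota_ltn_sorted 0 k) => i j /=; lia.
Qed.

(** The interval is half-open so that counts over adjacent intervals add up. Because of the absolute
    value, the count is meaningful only for lo <= hi. *)
Definition cnt (p : pred int) (lo hi : int) : nat :=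
  count p (rng lo `|hi - lo|%N).

Lemma cnt_cat p (lo mid hi : int) : lo <= mid <= hi ->
  cnt p lo hi = (cnt p lo mid + cnt p mid hi)%N.
Proof.
move=> h; rewrite /cnt.
have -> : `|hi - lo|%N = (`|mid - lo| + `|hi - mid|)%N by lia.
by rewrite rng_cat count_cat; do 3!f_equal; lia.
Qed.

Lemma cntS p (lo hi : int) : lo <= hi -> cnt p lo (hi + 1) = (cnt p lo hi + p hi)%N.
Proof.
move=> h; rewrite (@cnt_cat p lo hi); last lia.
congr (_ + _)%N; rewrite /cnt.
have -> : `|(hi + 1 - hi)%R|%N = 1%N by lia.
by rewrite /rng /= addr0 addn0.
Qed.

Lemma eq_cnt (p q : pred int) (lo hi : int) : lo <= hi ->
  (forall e, lo <= e < hi -> p e = q e) ->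
  cnt p lo hi = cnt q lo hi.
Proof.
by move=> lh h; apply: eq_in_count => e; rewrite mem_rng => ?; apply: h; lia.
Qed.

Lemma cnt_opp (p : pred int) (c lo hi : int) : lo <= hi ->
  cnt (fun e => p (c - e)) lo hi = cnt p (c - hi + 1) (c - lo + 1).
Proof.
move=> h; rewrite /cnt.
have -> : `|(c - lo + 1 - (c - hi + 1))%R|%N = `|hi - lo|%N by lia.
rewrite -(count_map (fun e => c - e) p); apply/seq.permP.
apply: uniq_perm => [||e].
- by rewrite (map_inj_uniq (f := fun e => c - e)) ?rng_uniq // => x y; lia.
- exact: rng_uniq.
rewrite mem_rng; apply/mapP/idP => [[x]|he]; first by rewrite mem_rng => ? ->; lia.
by exists (c - e); rewrite ?mem_rng; lia.
Qed.

Lemma cnt_pred0 (p : pred int) (lo hi : int) : lo <= hi ->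
  (forall e, lo <= e < hi -> p e = false) -> cnt p lo hi = 0%N.
Proof. by move=> lh h; rewrite (eq_cnt lh h) /cnt count_pred0. Qed.

Lemma gaps_cnt n a (lo hi : int) : lo < hi ->
  gaps_between n a lo hi = cnt (gap n a) (lo + 1) hi.
Proof.
move=> h; rewrite /gaps_between /cnt /rng.
have -> : `|(hi - (lo + 1))%R|%N = `|(hi - lo - 1)%R|%N by lia.
congr count; rewrite -{1}[1%N]addn0 iotaDl -map_comp; apply: eq_map => i /=; lia.
Qed.

(** * Rows of the core *)

Definition entry (n : nat) (e : int) : bool := ~~ (NN n %| e)%Z.

(* The i-th largest bead b ends row i, and rk b is the content of the last box of
   that row. *)
Definition rk (n : nat) (e : int) : int :=
  if NN n <= e then (cnt (entry n) (NN n) e)%:Z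
  else - (cnt (entry n) e (NN n))%:Z.

Lemma rkE n lo e : lo <= e -> lo <= NN n ->
  (cnt (entry n) lo e)%:Z = (cnt (entry n) lo (NN n))%:Z + rk n e.
Proof.
move=> loe loN; rewrite /rk; case: leP => h.
  by rewrite (cnt_cat _ (mid := NN n) (lo := lo) (hi := e)) ?loN //; lia.
by rewrite (cnt_cat _ (mid := e) (lo := lo) (hi := NN n)) ?loe ?ltW //; lia.
Qed.

Lemma cnt_gt0 (p : pred int) (lo hi : int) : lo < hi -> p lo -> (0 < cnt p lo hi)%N.
Proof.
move=> lh plo; rewrite /cnt -has_count; apply/hasP; exists lo => //.
by rewrite mem_rng; lia.
Qed.

Lemma lt_rk n e f : entry n e -> e < f -> rk n e < rk n f.
Proof.
move=> ee ef; rewrite /rk; have := cnt_gt0 ef ee.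
case: (leP (NN n) e) => h1; case: (leP (NN n) f) => h2; try lia.
- rewrite (cnt_cat _ (mid := e) (lo := NN n) (hi := f)); lia.
- have := cnt_gt0 h1 ee; lia.
- rewrite (cnt_cat _ (mid := f) (lo := e) (hi := NN n)); lia.
Qed.

Lemma rk_inj n e f : entry n e -> entry n f -> rk n e = rk n f -> e = f.
Proof.
move=> ee ef r; case: (ltrgtP e f) => // h.
  by have := lt_rk ee h; lia.
by have := lt_rk ef h; lia.
Qed.

Definition beadsR (a : pred int) (R : nat) : seq int :=
  rev [seq e <- rng (- R%:Z) R.*2.+1 | a e].

(** [core] with an arbitrary bound in place of the radius; by [coreR_le] every larger bound gives
    the same partition. *)
Definition coreR (n : nat) (a : pred int) (R : nat) : seq nat :=
  [seq m <- [seq gaps_between n a (- R%:Z - 1) b | b <- beadsR a R] | (0 < m)%N].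

Lemma beads_descE n w : beads_desc n w = beadsR (abacus n w) (radius n w).
Proof.
rewrite /beadsR /beads_desc -filter_rev; congr filter.
apply: (@eq_from_nth _ 0) => [|i]; first by rewrite size_rev !size_map.
rewrite size_map size_iota => hi.
rewrite nth_rev size_map ?size_iota // !(nth_map 0%N) ?size_iota ?nth_iota //; lia.
Qed.

Lemma coreE n w : core n w = coreR n (abacus n w) (radius n w).
Proof. by rewrite /core beads_descE. Qed.

Lemma mem_beadsR a R e : (e \in beadsR a R) = a e && (- R%:Z <= e <= R%:Z).
Proof. by rewrite mem_rev mem_filter mem_rng; congr (_ && _); lia. Qed.

Lemma beadsR_sorted a R : sorted >%R (beadsR a R).
Proof. by rewrite rev_sorted (sorted_filter lt_trans) // rng_sorted. Qed.

Lemma count_sorted_gt (s : seq int) i : sorted >%R s -> (i < size s)%N ->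
  count (fun x => nth 0 s i < x) s = i.
Proof.
elim: s i => //= x s IH i hp hi.
have hs : sorted >%R s := path_sorted hp.
have hx : all (fun y => y < x) s by apply: (order_path_min _ hp) => a b c /=; lia.
case: i hi => [_|i hi].
  rewrite ltxx add0n; apply/eqP; rewrite -leqn0 leqNgt -has_count.
  by apply/hasPn => y /(allP hx) /=; lia.
rewrite [nth _ _ _]/= (allP hx (nth 0 s i)) ?mem_nth //.
by rewrite add1n; congr _.+1; apply: IH.
Qed.

(** In a weakly decreasing list the zeros form a tail, so removing them changes no value of [nth]
    with default 0. *)
Lemma nth_filter_pos (l : seq nat) i : sorted geq l ->
  nth 0%N [seq m <- l | (0 < m)%N] i = nth 0%N l i.
Proof.
elim: l i => //= x l IH i hp; have hl := path_sorted hp.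
case: ifP => hx; first by case: i => //= i; apply: IH.
have hall : all (fun y => y <= x)%N l.
  by apply: (order_path_min _ hp) => a b c /=; lia.
rewrite IH //; case: i => [|i] /=.
  by case: (l) hall => [|y l'] /=; lia.
have h0 j : nth 0%N l j = 0%N.
  have [jl|jl] := ltnP j (size l); last by rewrite nth_default.
  by have /= := allP hall _ (mem_nth 0%N jl); lia.
by rewrite !h0.
Qed.

Section GoodAbacus.

Variables (n : nat) (a : pred int) (R : nat).
Hypothesis ga : good n a R.

Lemma good_entry e : a e -> entry n e.
Proof. by apply: contraL => /(good_div ga)->. Qed.

Lemma cnt_gap_bead (lo hi : int) : lo <= hi ->
  (cnt (gap n a) lo hi + cnt a lo hi = cnt (entry n) lo hi)%N.
Proof.
move=> h; rewrite /cnt -(count_predUI (gap n a) a) [X in (_ + X)%N](_ : _ = 0%N).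
  rewrite addn0; apply: eq_count => e /=; rewrite /gap /entry.
  by case hd: (NN n %| e)%Z => /=; [rewrite (good_div ga)|case: (a e)].
apply/eqP; rewrite -leqn0 leqNgt -has_count; apply/hasPn => e _ /=.
by rewrite /gap; case: (a e); rewrite ?andbF.
Qed.

Lemma cnt_mirror (lo hi : int) : lo <= hi ->
  cnt (gap n a) lo hi = cnt a (NN n + NN n - hi + 1) (NN n + NN n - lo + 1).
Proof.
move=> h; rewrite -cnt_opp //; apply: eq_cnt => // e _; rewrite /gap.
case hd: (NN n %| e)%Z => /=; first by rewrite (good_div ga) // dvd_mirror.
by rewrite (good_mirror ga) // hd.
Qed.

(** The reflection turns the beads above N into the gaps below N, so that pushing all beads down
    fills exactly the entries below N. This is why [rk] is centred at N. *)
Lemma cnt_beads : cnt a (- R%:Z) (R%:Z + 1) = cnt (entry n) (- R%:Z) (NN n).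
Proof.
have N0 := NN_gt0 n.
have -> : cnt a (- R%:Z) (R%:Z + 1) = cnt a (- R%:Z) (NN n + NN n + R%:Z + 1).
  rewrite [RHS](cnt_cat _ (mid := R%:Z + 1)); last lia.
  rewrite [X in (_ + X)%N]cnt_pred0 ?addn0 //; first lia.
  by move=> e ?; apply: (good_high ga); lia.
rewrite (cnt_cat _ (mid := NN n)); last lia.
have -> : cnt a (NN n) (NN n + NN n + R%:Z + 1) = cnt (gap n a) (- R%:Z) (NN n).
  have := @cnt_mirror (- R%:Z) (NN n + 1); rewrite opprK.
  have -> : NN n + NN n - (NN n + 1) + 1 = NN n by lia.
  move=> <-; last lia.
  rewrite cntS; last lia.
  by rewrite /gap dvdzz addn0.
by rewrite addnC cnt_gap_bead //; lia.
Qed.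

(** The gaps below b are the entries below b minus the beads there, and [cnt_beads] trades the beads
    below b for those from b on. *)
Lemma gaps_below b : a b -> - R%:Z <= b <= R%:Z ->
  (gaps_between n a (- R%:Z - 1) b)%:Z = (cnt a b (R%:Z + 1))%:Z + rk n b.
Proof.
move=> ab hb; rewrite gaps_cnt; last lia.
rewrite subrK; have N0 := NN_gt0 n.
have h1 : (cnt a (- R%:Z) (R%:Z + 1) = cnt a (- R%:Z) b + cnt a b (R%:Z + 1))%N.
  by apply: cnt_cat; lia.
have h2 := @cnt_gap_bead (- R%:Z) b; have h3 := cnt_beads.
have := @rkE n (- R%:Z) b; lia.
Qed.

Lemma cnt_above i : (i < size (beadsR a R))%N ->
  cnt a (nth 0 (beadsR a R) i) (R%:Z + 1) = i.+1.
Proof.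
move=> hi; set b := nth _ _ _.
have := mem_nth 0 hi; rewrite -/b mem_beadsR => /andP[ab hb].
rewrite (cnt_cat _ (mid := b + 1)); last lia.
have -> : cnt a b (b + 1) = 1%N.
  by rewrite cntS // ab /cnt subrr.
rewrite -[in RHS](count_sorted_gt (beadsR_sorted a R) hi) -/b.
rewrite /beadsR count_rev count_filter -/(cnt _ _ _).
have -> : count (predI (fun x => b < x) a) (rng (- R%:Z) R.*2.+1) =
          cnt (predI (fun x => b < x) a) (- R%:Z) (R%:Z + 1).
  by rewrite /cnt; do 2!f_equal; lia.
rewrite (cnt_cat _ (lo := - R%:Z) (mid := b + 1)); last lia.
rewrite add1n; congr _.+1.
rewrite [X in _ = (X + _)%N]cnt_pred0 ?add0n; first 1 last; first lia.
  by move=> e he /=; have -> : (b < e) = false by lia.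
by apply: eq_cnt => [|e he /=]; [lia|have -> : b < e by lia].
Qed.

Lemma gaps_sorted :
  sorted geq [seq gaps_between n a (- R%:Z - 1) b | b <- beadsR a R].
Proof.
rewrite sorted_map.
apply: (sub_in_sorted (P := mem (beadsR a R))) (beadsR_sorted a R); last first.
  exact/allP.
move=> e f; rewrite /= !mem_beadsR => he hf fe.
rewrite !gaps_cnt; try lia.
by rewrite (cnt_cat _ (mid := f) (hi := e)); lia.
Qed.

Lemma row_len_core i : (i < size (beadsR a R))%N ->
  (row_len (coreR n a R) i.+1)%:Z = i.+1%:Z + rk n (nth 0 (beadsR a R) i).
Proof.
move=> hi; rewrite /row_len /= nth_filter_pos ?gaps_sorted // (nth_map 0) //.
have := mem_nth 0 hi; rewrite mem_beadsR => /andP[ab hb].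
by rewrite gaps_below // cnt_above.
Qed.

Lemma row_len_core0 i : (size (beadsR a R) <= i)%N ->
  row_len (coreR n a R) i.+1 = 0%N.
Proof.
move=> hi; rewrite /row_len /= nth_filter_pos ?gaps_sorted // nth_default //.
by rewrite size_map.
Qed.

Lemma size_beadsR : (size (beadsR a R))%:Z = (cnt (entry n) (- R%:Z) (NN n))%:Z.
Proof.
rewrite -cnt_beads /beadsR size_rev size_filter /cnt.
by do 3!f_equal; lia.
Qed.

Lemma bead_rank e : entry n e -> - R%:Z <= e <= R%:Z ->
  a e <-> exists i, (row_len (coreR n a R) i.+1)%:Z = i.+1%:Z + rk n e.
Proof.
move=> ee he; split=> [ae|[i hi]].
  have eB : e \in beadsR a R by rewrite mem_beadsR ae.
  exists (index e (beadsR a R)); rewrite row_len_core ?index_mem //.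
  by rewrite nth_index.
have [iB|iB] := ltnP i (size (beadsR a R)).
  move: hi; rewrite row_len_core // => hi.
  have := mem_nth 0 iB; rewrite mem_beadsR => /andP[ab _].
  suff -> : e = nth 0 (beadsR a R) i by [].
  by apply: (@rk_inj n) => //; [exact: good_entry|lia].
(* Past the listed beads the rows are empty, and row i + 1 would require a rank below minus the
   number of beads, which no entry from -R on has. *)
move: hi; rewrite row_len_core0 // => hi.
have := @rkE n (- R%:Z) e; have := NN_gt0 n; have := size_beadsR; lia.
Qed.

(** A larger bound adds no gap on the left and no bead on the right; at most it adds a bead at -R -
    1, which ends an empty row. *)
Lemma coreR_succ : coreR n a R.+1 = coreR n a R.
Proof.
have hN : a R.+1%:Z = false by apply: (good_high ga); lia.
have hB : beadsR a R.+1 =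
    beadsR a R ++ (if a (- R.+1%:Z) then [:: - R.+1%:Z] else [::]).
  rewrite /beadsR.
  have -> : R.+1.*2.+1 = (1 + (R.*2.+1 + 1))%N by lia.
  rewrite !rng_cat !filter_cat !rev_cat.
  have -> : - R.+1%:Z + 1%N%:Z = - R%:Z by lia.
  have -> : - R%:Z + R.*2.+1%:Z = R.+1%:Z by lia.
  have r1 x : rng x 1 = [:: x] by rewrite /rng /= addr0.
  rewrite !r1 [filter a [:: R.+1%:Z]]/= hN cat0s.
  by rewrite [filter a [:: _]]/=; case: (a (- R.+1%:Z)).
rewrite /coreR hB map_cat filter_cat.
have hg : gap n a (- R.+1%:Z) = false.
  rewrite /gap; case hd: (NN n %| - R.+1%:Z)%Z => //=.
  by rewrite (good_low ga) ?hd //; lia.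
have e1 : [seq gaps_between n a (- R.+1%:Z - 1) b | b <- beadsR a R] =
          [seq gaps_between n a (- R%:Z - 1) b | b <- beadsR a R].
  apply/eq_in_map => b; rewrite mem_beadsR => /andP[_ hb].
  rewrite !gaps_cnt; try lia.
  rewrite (cnt_cat _ (mid := - R%:Z)); last lia.
  have -> : - R%:Z = - R.+1%:Z - 1 + 1 + 1 by lia.
  rewrite cntS; last lia.
  have -> : - R.+1%:Z - 1 + 1 = - R.+1%:Z by lia.
  rewrite hg {1}/cnt.
  have -> : - R.+1%:Z + 1 - 1 + 1 = - R.+1%:Z + 1 by lia.
  by rewrite subrr /= add0n.
rewrite e1 [X in _ ++ X](_ : _ = [::]) ?cats0 //.
case: (a _) => //=; rewrite gaps_cnt; last lia.
by rewrite subrK /cnt subrr.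
Qed.

End GoodAbacus.

Lemma good_le n a R R' : (R <= R')%N -> good n a R -> good n a R'.
Proof.
move=> h [h1 h2 h3 h4 h5]; split=> // e.
  by move=> ?; apply: h4; lia.
by move=> ? ?; apply: h5 => //; lia.
Qed.

Lemma coreR_le n a R R' : (R <= R')%N -> good n a R -> coreR n a R' = coreR n a R.
Proof.
move=> /subnKC <- ga; elim: (R' - R)%N => [|k IH]; first by rewrite addn0.
by rewrite addnS coreR_succ //; apply: good_le ga; apply: leq_addr.
Qed.

Lemma core_eq_coreR n w R : mirrored n w -> (radius n w <= R)%N ->
  core n w = coreR n (abacus n w) R.
Proof. by move=> mw h; rewrite coreE (coreR_le h) //; apply: abacus_good. Qed.

(** [gen_acts] sees an element only through its core. This lemma lets its witness be replaced by the
    given element, since everything later depends on the abacus alone. *)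
Lemma core_inj n w w' : mirrored n w -> mirrored n w' ->
  core n w = core n w' -> abacus n w =1 abacus n w'.
Proof.
move=> mw mw' ww' e; case hd: (NN n %| e)%Z.
  by rewrite (good_div (abacus_good mw)) // (good_div (abacus_good mw')).
have ee : entry n e by rewrite /entry hd.
pose R := maxn `|e| (maxn (radius n w) (radius n w')).
have gw : good n (abacus n w) R by apply: good_le (abacus_good mw); lia.
have gw' : good n (abacus n w') R by apply: good_le (abacus_good mw'); lia.
have eR : - R%:Z <= e <= R%:Z by lia.
move: ww'; rewrite (core_eq_coreR mw (R := R)); last lia.
rewrite (core_eq_coreR mw' (R := R)); last lia.
have h1 := bead_rank gw ee eR; have h2 := bead_rank gw' ee eR.
by move=> ww'; apply/idP/idP; rewrite h1 h2 ww'.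
Qed.

(** * Sizes of the parts *)

(* w 1, ..., w 2n are the largest beads of the runners; the number of gaps between
   a bead b and b - N is tops_before n w (b - NN n). *)
Definition tops_before (n : nat) (w : int -> int) (y : int) : nat :=
  count (fun i : nat => w i%:Z < y) (iota 1 n.*2).

Definition top (n : nat) (w : int -> int) (y : int) : bool :=
  abacus n w y && ~~ abacus n w (y + NN n).

Lemma entryP n e : entry n e -> e != 0 /\ e != NN n /\ e != NN n + NN n.
Proof.
move=> he; split; [|split]; apply: contraNneq he => ->; apply/dvdzP.
- by exists 0; rewrite mul0r.
- by exists 1; rewrite mul1r.
- by exists 2; lia.
Qed.

Lemma entry_mul n (q e : int) : q * NN n < e < q * NN n + NN n -> entry n e.
Proof.
move=> h; apply/negP => /dvdzP[m em]; move: h; rewrite em -[X in _ + X]mul1r -mulrDl.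
by rewrite !ltr_pM2r //; lia.
Qed.

Lemma cnt_all (p : pred int) (lo hi : int) : lo <= hi ->
  (forall e, lo <= e < hi -> p e) -> (cnt p lo hi)%:Z = hi - lo.
Proof.
move=> lh h; rewrite (eq_cnt (q := predT)) => [|//|e /h-> //].
by rewrite /cnt count_predT size_map size_iota; lia.
Qed.

(** The last bead of a runner is an entry whose preimage lies strictly between 0 and N, that is,
    among 1, ..., 2n. *)
Lemma topE n w y : mirrored n w ->
  count (fun i : nat => w i%:Z == y) (iota 1 n.*2) = top n w y.
Proof.
move=> mw; have [g [wK gK gN _]] := mirrored_inv mw.
rewrite /top !(abacusE _ mw wK gK) dvd_addN gN.
have -> : [&& ~~ (NN n %| y)%Z && (g y < NN n) &
           ~~ (~~ (NN n %| y)%Z && (g y + NN n < NN n))] = (0 < g y < NN n).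
  have -> : (NN n %| y)%Z = (NN n %| g y)%Z by rewrite -(dvd_mirrored (g y) mw) gK.
  case hd: (NN n %| g y)%Z => /=.
    apply/esym/negP => h; have := @entry_mul n 0 (g y).
    by rewrite /entry hd; move: h (NN_gt0 n); lia.
  have : g y != 0 by apply: contraFneq hd => ->.
  by move: (g y) (NN n) => x N; lia.
rewrite (@eq_count _ _ (fun i : nat => i%:Z == g y)); last first.
  by move=> i; rewrite (can2_eq wK gK).
case hg: (0 < g y < NN n).
  rewrite (@eq_count _ _ (pred1 `|g y|%N)); last by move=> i /=; lia.
  rewrite count_uniq_mem ?iota_uniq // mem_iota.
  by move: hg; rewrite /NN; lia.
rewrite (@eq_in_count _ _ pred0) ?count_pred0 // => i; rewrite mem_iota.
by move: hg; rewrite /NN /=; lia.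
Qed.

Lemma tops_beforeS n w y : mirrored n w ->
  tops_before n w (y + 1) = (tops_before n w y + top n w y)%N.
Proof.
move=> mw; rewrite -topE // /tops_before -count_predUI.
rewrite [X in _ = (_ + X)%N](_ : _ = 0%N) ?addn0.
  by apply: eq_count => i /=; lia.
apply/eqP; rewrite -leqn0 leqNgt -has_count; apply/hasPn => i _ /=; lia.
Qed.

Lemma tops_before_le n w y z : y <= z ->
  (tops_before n w y <= tops_before n w z)%N.
Proof. by move=> yz; apply: sub_count => i /=; lia. Qed.

Lemma tops_before_add n w (y z : int) : mirrored n w -> y <= z ->
  (forall e, y <= e < z -> top n w e) ->
  (tops_before n w z)%:Z = (tops_before n w y)%:Z + (z - y).
Proof.
move=> mw yz; have [k ->] : exists k : nat, z = y + k%:Z by exists `|z - y|%N; lia.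
elim: k => [|k IH] h; first by rewrite addr0; lia.
have -> : y + k.+1%:Z = y + k%:Z + 1 by lia.
rewrite tops_beforeS // h; last lia.
rewrite PoszD IH; first lia.
by move=> e he; apply: h; lia.
Qed.

(** When the window of length N slides up by one, it loses y and gains y + N; by flushness the
    number of gaps grows exactly if y is the last bead of its runner. Far below, both counts
    vanish. *)
Lemma gaps_tops n w y : mirrored n w ->
  cnt (gap n (abacus n w)) y (y + NN n) = tops_before n w y.
Proof.
move=> mw; have gw := abacus_good mw; have N0 := NN_gt0 n.
have base z : z <= - (radius n w)%:Z - NN n ->
    cnt (gap n (abacus n w)) z (z + NN n) = tops_before n w z.
  move=> hz; rewrite cnt_pred0; first 1 last; first lia.
    move=> e he; rewrite /gap; case hd: (NN n %| e)%Z => //=.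
    by rewrite (good_low gw) ?hd //; lia.
  apply/esym/eqP; rewrite -leqn0 leqNgt -has_count; apply/hasPn => i.
  rewrite mem_iota => hi; have : (0 < i <= n.*2)%N by lia.
  by move=> /(le_radius w); lia.
have [hy|hy] := leP y (- (radius n w)%:Z - NN n); first exact: base.
have [k ->] : exists k : nat, y = - (radius n w)%:Z - NN n + k%:Z.
  by exists `|(y + (radius n w)%:Z + NN n)%R|%N; lia.
move: (- _ - _) (base _ (lexx _)) => z hz.
elim: k => [|k IH]; first by rewrite addr0.
have -> : z + k.+1%:Z = z + k%:Z + 1 by lia.
rewrite tops_beforeS // -IH; move: (z + k%:Z) => x.
have xN : x <= x + 1 <= x + NN n + 1 by lia.
have h1 := @cntS (gap n (abacus n w)) x (x + NN n) ltac:(lia).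
have h2 := cnt_cat (gap n (abacus n w)) xN.
have h3 : cnt (gap n (abacus n w)) x (x + 1) = gap n (abacus n w) x.
  by rewrite cntS // /cnt subrr.
have h4 : gap n (abacus n w) (x + NN n) =
    (gap n (abacus n w) x + top n w x)%N :> nat.
  rewrite /gap /top dvd_addN; case hd: (NN n %| x)%Z => /=.
    by rewrite (good_div gw).
  case h: (abacus n w x) => //=; case h': (abacus n w (x + NN n)) => //=.
  by have := good_sub gw h'; rewrite addrK h.
have -> : x + 1 + NN n = x + NN n + 1 by lia.
move: h1; rewrite h2 h3 h4 => h1.
by apply/eqP; rewrite -(eqn_add2l (gap n (abacus n w) x)) h1 addnCA.
Qed.

Lemma gaps_bead n w b : mirrored n w -> abacus n w b ->
  gaps_between n (abacus n w) (b - NN n) b = tops_before n w (b - NN n).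
Proof.
move=> mw ab; have N0 := NN_gt0 n; have gw := abacus_good mw.
rewrite gaps_cnt; last lia.
rewrite -gaps_tops // subrK [RHS](cnt_cat _ (mid := b - NN n + 1)); last lia.
by rewrite cntS // /cnt subrr /= /gap (good_sub gw ab) andbF.
Qed.

(** The reflection maps the window from n + 1 to N + n onto itself, so half of its 2n entries are
    gaps. *)
Lemma tops_before_half n w : mirrored n w -> tops_before n w (n%:Z + 1) = n.
Proof.
move=> mw; have gw := abacus_good mw; have NE := NNE n.
rewrite -gaps_tops //.
have h1 := @cnt_gap_bead _ _ _ gw (n%:Z + 1) (n%:Z + 1 + NN n).
have h2 := @cnt_mirror _ _ _ gw (n%:Z + 1) (n%:Z + 1 + NN n).
have e1 : NN n + NN n - (n%:Z + 1 + NN n) + 1 = n%:Z + 1 by lia.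
have e2 : NN n + NN n - (n%:Z + 1) + 1 = n%:Z + 1 + NN n by lia.
rewrite e1 e2 in h2.
have h3 : (cnt (entry n) (n%:Z + 1) (n%:Z + 1 + NN n))%:Z = n%:Z + n%:Z.
  rewrite (cnt_cat _ (mid := NN n)); last lia.
  rewrite (cnt_cat _ (lo := NN n) (mid := NN n + 1)); last lia.
  rewrite cntS // !PoszD /entry dvdzz {2}/cnt subrr /=.
  rewrite !cnt_all; try lia.
    by move=> e he; apply: (@entry_mul n 1); lia.
  by move=> e he; apply: (@entry_mul n 0); lia.
by lia.
Qed.

Definition threshold (t : affine_type) (n : nat) : int :=
  NN n + (ref_diag t)%:Z.

(** These beads end the rows that reach the reference diagonal ([ref_rowE]), and they are the beads
    above N with a nonzero part: if x_0 = -1, a bead at N + 1 has part 0. *)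
Definition live_beads (t : affine_type) (n : nat) (w : int -> int) : seq int :=
  [seq e <- beads_desc n w | threshold t n < e].

Lemma threshold_bounds t n : NN n <= threshold t n <= NN n + 1.
Proof. by rewrite /threshold; case: t => /=; lia. Qed.

Lemma mem_live t n w e : mirrored n w ->
  (e \in live_beads t n w) = abacus n w e && (threshold t n < e).
Proof.
move=> mw; rewrite mem_filter beads_descE mem_beadsR andbC -andbA.
case ae: (abacus n w e) => //=; apply/andb_idl => he.
have := threshold_bounds t n; have := NN_gt0 n.
have : e <= radius n w.
  by rewrite leNgt; apply: contraTN ae => h; rewrite (good_high (abacus_good mw)).
lia.
Qed.

Lemma live_sorted t n w : sorted >%R (live_beads t n w).
Proof.
rewrite /live_beads beads_descE; apply: sorted_filter (beadsR_sorted _ _) => x y z /=; lia.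
Qed.

Definition least (t : affine_type) (n : nat) (w : int -> int) (b : int) : Prop :=
  [/\ abacus n w b, threshold t n < b
    & forall e, threshold t n < e < b -> abacus n w e = false].

Lemma least_live t n w Q b : mirrored n w -> live_beads t n w = rcons Q b ->
  least t n w b.
Proof.
move=> mw hQ; have := mem_live t b mw; rewrite hQ mem_rcons mem_head.
case/esym/andP=> ab hb; split=> // e he; apply/negP => ae.
have : e \in rcons Q b by rewrite -hQ mem_live // ae; lia.
rewrite mem_rcons inE => /orP[/eqP eb|eQ]; first lia.
have := live_sorted t n w; rewrite hQ -rev_sorted rev_rcons /= => hp.
have /allP/(_ e) := order_path_min lt_trans hp.
by rewrite mem_rev => /(_ eQ) /=; lia.
Qed.

Lemma refE t : (ref_diag t)%:Z = - x0 t.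
Proof. by case: t. Qed.

(** By flushness b - N is a bead, and by minimality it is not live. The exception occurs because N +
    1 is above N without being live when the reference diagonal is the first one. *)
Lemma least_bound t n w b : mirrored n w -> least t n w b ->
  b < NN n + NN n \/ [/\ left_fork t, b = NN n + NN n + 1 & abacus n w (NN n + 1)].
Proof.
move=> mw [ab hb hl]; have gw := abacus_good mw.
have h : abacus n w (b - NN n) := good_sub gw ab.
have [h'|h'] := ltP b (NN n + NN n); [by left|right].
have := entryP (good_entry gw ab); have := entryP (good_entry gw h).
move: hb hl; rewrite /threshold; have N0 := NN_gt0 n.
have [e1 |e1] : b - NN n <= threshold t n \/ threshold t n < b - NN n by lia.
  move: e1 h; rewrite /threshold; case: t => /= e1 h hb hl [? []] *; try lia;
    (have -> : NN n + 1 = b - NN n by lia); split=> //; lia.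
by move=> hb hl; move: (hl (b - NN n)); rewrite h; move: e1; rewrite /threshold; lia.
Qed.

(** For p from n + 1 up to b - N, both p + N and 2N - p fall among the gaps between the threshold
    and b; by reflection p is a bead, hence the top of its runner. The n tops up to n come from
    [tops_before_half]. If b = 2N + 1, the positions N - 1 (a gap) and N (no entry) contribute
    nothing. *)
Lemma least_gaps t n w b : (min_rank t <= n)%N -> mirrored n w ->
  least t n w b -> NN n + n%:Z < b ->
  (gaps_between n (abacus n w) (b - NN n) b)%:Z =
  if b < NN n + NN n then b - NN n - 1 else NN n - 2.
Proof.
move=> hn mw lb hb; have gw := abacus_good mw; have [ab hb' hl] := lb.
have n2 := (rank_bound hn).1; have NE := NNE n.
have ht := threshold_bounds t n.
have tops (p : int) : n%:Z + 1 <= p < b - NN n -> p < NN n + NN n - threshold t n ->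
    top n w p.
  move=> hp hp'; rewrite /top (hl (p + NN n)) ?andbT; last lia.
  have := good_mirror gw (e := NN n + NN n - p).
  have -> : NN n + NN n - (NN n + NN n - p) = p by lia.
  rewrite dvd_mirror => ->; last by apply: (@entry_mul n 0); lia.
  by rewrite (hl (NN n + NN n - p)) //; lia.
rewrite gaps_bead //; have hh := tops_before_half mw.
case: (least_bound mw lb) => [h|[lf h a1]].
  rewrite h (@tops_before_add n w (n%:Z + 1)) ?hh //; try lia.
  by move=> e he; apply: tops => //; lia.
have -> : (b < NN n + NN n) = false by lia.
have tN : threshold t n = NN n + 1 by move: lf; rewrite /threshold; case: (t).
have -> : b - NN n = NN n - 1 + 1 + 1 by lia.
rewrite !tops_beforeS //.
have -> : top n w (NN n - 1 + 1) = false.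
  by rewrite subrK /top (good_div gw) // dvdzz.
have -> : top n w (NN n - 1) = false.
  rewrite /top; have := good_mirror gw (e := NN n + 1).
  have -> : NN n + NN n - (NN n + 1) = NN n - 1 by lia.
  by move=> ->; [rewrite a1|apply: (@entry_mul n 1); lia].
rewrite !addn0 (@tops_before_add n w (n%:Z + 1)) ?hh //; try lia.
by move=> e he; apply: tops => //; lia.
Qed.

Lemma least_part t n w b : (min_rank t <= n)%N -> mirrored n w ->
  least t n w b ->
  (bead_part t n (abacus n w) b).1 =
  if NN n + NN n < b then NN n - 1 + x0 t + xn t
  else if NN n + n%:Z < b then b - NN n + x0 t + xn t else b - NN n + x0 t.
Proof.
move=> hn mw lb; rewrite /bead_part; have NE := NNE n.
case: ltP => hb /=; last by rewrite ifF //; lia.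
rewrite (least_gaps hn mw lb hb).
by case: (least_bound mw lb) => [h|[_ h _]]; rewrite ?h; do !case: ifP; lia.
Qed.

Lemma part_ge t n w e : (min_rank t <= n)%N -> mirrored n w ->
  abacus n w e -> threshold t n < e ->
  1 <= (bead_part t n (abacus n w) e).1.
Proof.
move=> hn mw ae he; rewrite /bead_part; case: ltP => h /=; last first.
  by move: he; rewrite /threshold refE; lia.
rewrite gaps_bead //; have := tops_before_half mw.
have : n%:Z + 1 <= e - NN n by lia.
move=> /(tops_before_le n w); have := rank_bound hn.
by case: (t) => /=; lia.
Qed.

(** * A peeling step on the abacus *)

(* These conditions say that s_k lowers the bead b and keeps the order of the beads
   above b - N, so that it lowers no part but the one of b. The last two control
   the beads near N + n, where the formula for the parts changes. *)
Record peels (t : affine_type) (n k : nat) (w : int -> int) (b : int) : Prop :=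
Peels {
  peels_low : low t n k (b - shift t n k);
  peels_gap : forall x, low t n k x -> b - NN n <= x -> ~~ abacus n w x;
  peels_straddle : forall e x, abacus n w e -> b < e -> abacus n w x ->
    x < b - NN n -> gen t n k x < gen t n k (e - NN n);
  peels_stay : forall e, abacus n w e -> b < e -> threshold t n < gen t n k e;
  peels_cross : forall e, abacus n w e -> e <= threshold t n ->
    gen t n k e <= threshold t n;
  peels_fix : forall e, abacus n w e -> b < e -> e <= NN n + n%:Z ->
    gen t n k e = e;
  peels_fork : forall e, abacus n w e -> b < e -> NN n + n%:Z < e ->
    gen t n k e <= NN n + n%:Z ->
    [/\ right_fork t, k = n, b = NN n + n%:Z + 1 & e = NN n + n%:Z + 2] }.

Section PeelingStep.

Variables (t : affine_type) (n k : nat) (w : int -> int) (b : int).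
Hypotheses (hn : (min_rank t <= n)%N) (hk : (k <= n)%N) (mw : mirrored n w)
  (hlow : least t n w b) (hp : peels t n k w b).

Let s := gen t n k.
Let w' := s \o w.

Lemma step_mirrored : mirrored n w'.
Proof. by apply: mirrored_comp => //; apply: gen_mirrored. Qed.

Lemma step_abacus e : abacus n w' e = abacus n w (s e).
Proof. exact: abacus_gen. Qed.

Lemma step_mono e f : abacus n w e -> abacus n w f -> b <= e -> e < f ->
  s e < s f.
Proof.
move=> ae af be ef; rewrite lt_neqAle (inj_eq (inv_inj (genK hn hk))).
rewrite (lt_eqF ef) /= leNgt; apply/negP => fe.
have N0 := NN_gt0 n.
have := gen_inversion hn hk (good_entry (abacus_good mw) ae) ef fe.
by move=> /(peels_gap hp); rewrite ae => /(_ _)/implyP; lia.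
Qed.

(** A change of order between a top x and e - N would be an inversion, whose lower member is a low
    bead. From b - N on this is excluded by [peels_gap]; below b - N low beads may occur, whence
    [peels_straddle]. *)
Lemma step_tops e : abacus n w e -> b < e ->
  tops_before n w' (s e - NN n) = tops_before n w (e - NN n).
Proof.
move=> ae be; apply: eq_in_count => i; rewrite mem_iota => hi.
have gw := abacus_good mw.
have [g [wK gK _ _]] := mirrored_inv mw.
have ai : abacus n w (w i%:Z).
  rewrite (abacusE _ mw wK gK) wK dvd_mirrored //.
  apply/andP; split; [apply: (@entry_mul n 0)|]; rewrite /NN; lia.
have yb : b - NN n <= e - NN n by lia.
rewrite /w' /= -/s /s -gen_subN //; set x := w i.
have hs x' := @peels_straddle _ _ _ _ _ hp e x' ae be.
have ay := good_sub gw ae; move: (e - NN n) hs ay yb.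
move=> y hs ay yb.
apply/idP/idP.
  rewrite ltNge => h; rewrite ltNge; apply: contra h.
  rewrite le_eqVlt => /orP[/eqP->//|yx]; rewrite leNgt; apply/negP => xy.
  have := gen_inversion hn hk (good_entry gw ay) yx xy.
  by move=> /(peels_gap hp)/(_ yb); rewrite ay.
move=> xy; have [hx|hx] := ltP x (b - NN n); first exact: hs.
rewrite lt_neqAle (inj_eq (inv_inj (genK hn hk))) (lt_eqF xy) /= leNgt.
apply/negP => yx; have := gen_inversion hn hk (good_entry gw ai) xy yx.
by move=> /(peels_gap hp)/(_ hx); rewrite ai.
Qed.

Lemma step_live Q : live_beads t n w = rcons Q b ->
  live_beads t n w' =
  [seq s e | e <- Q] ++ (if threshold t n < s b then [:: s b] else [::]).
Proof.
move=> hQ; have := least_live mw hQ.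
have gb e : e \in rcons Q b -> abacus n w e /\ b <= e.
  rewrite -hQ mem_live // => /andP[ae he]; split=> //; rewrite leNgt.
  by apply/negP => eb; have [_ _ /(_ e)] := hlow; rewrite ae; lia.
have uQ : uniq (rcons Q b).
  rewrite -hQ; apply: (sorted_uniq _ _ (live_sorted t n w)) => [x y z|x] /=; lia.
have gQ e : e \in Q -> abacus n w e /\ b < e.
  move=> eQ; have [] := gb e; first by rewrite mem_rcons inE eQ orbT.
  move=> ae be; split=> //; rewrite lt_neqAle be andbT eq_sym.
  by apply: contraTneq eQ => ->; move: uQ; rewrite rcons_uniq => /andP[].
move=> _.
have -> : [seq s e | e <- Q] ++ (if threshold t n < s b then [:: s b] else [::])
        = [seq e <- [seq s e | e <- rcons Q b] | threshold t n < e].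
  rewrite map_rcons -cats1 filter_cat /=; congr (_ ++ _).
  apply/esym/all_filterP/allP => _ /mapP[e /gQ[ae be] ->].
  exact: (peels_stay hp).
(* Both lists are strictly decreasing, so it suffices to compare their members; [peels_cross]
   prevents a new bead from rising above the threshold. *)
apply: (irr_sorted_eq (leT := >%R)) => [x y z /=|x /=|||x]; try lia.
- exact: live_sorted.
- apply: sorted_filter => [x y z /=|]; first lia.
  rewrite sorted_map; apply: (sub_in_sorted (P := mem (rcons Q b))).
  + move=> e f /gb[ae be] /gb[af bf] /= fe; exact: step_mono af ae bf fe.
  + exact/allP.
  + by rewrite -hQ; exact: live_sorted.
rewrite (mem_live _ _ step_mirrored) step_abacus mem_filter andbC.
case hx: (threshold t n < x) => //=; apply/idP/mapP => [ax|[e]].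
  exists (s x); last by rewrite /s genK.
  rewrite -hQ mem_live // ax ltNge; apply/negP => hsx.
  by have := peels_cross hp ax hsx; rewrite genK // leNgt hx.
by move=> /gb[ae _] ->; rewrite /s genK.
Qed.

(* The only part that changes sides is the one of the bead N + n + 2, which
   s_n^D brings to N + n: both formulas give the same size. *)
Lemma step_part e : abacus n w e -> b < e ->
  (bead_part t n (abacus n w') (s e)).1 = (bead_part t n (abacus n w) e).1.
Proof.
move=> ae be; have ase : abacus n w' (s e) by rewrite step_abacus /s genK.
rewrite /bead_part; case: (ltP (NN n + n%:Z) e) => he; last first.
  by rewrite /s (peels_fix hp) // ltNge he.
have mw' := step_mirrored.
case: (ltP (NN n + n%:Z) (s e)) => hse /=.
  by rewrite !gaps_bead // step_tops.
have [rf kn hb he'] := peels_fork hp ae be he hse.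
have -> : s e = NN n + n%:Z.
  have := shift_bounds t n k; rewrite /s kn.
  have n3 := rank_bound hn.
  have sh : shift t n n = 2.
    by rewrite /shift rf eqxx; case: eqP => //; lia.
  by move: hse; rewrite /s kn; case: genP => //; rewrite sh; lia.
rewrite gaps_bead // he'.
have -> : NN n + n%:Z + 2 - NN n = n%:Z + 1 + 1 by lia.
rewrite tops_beforeS // tops_before_half //.
have -> : top n w (n%:Z + 1) = false.
  rewrite /top; have -> : n%:Z + 1 + NN n = b by lia.
  by have [-> _ _] := hlow; rewrite andbF.
by move: rf; case: (t) => //= _; lia.
Qed.

End PeelingStep.

(** * Generators that peel the least live bead *)

Lemma residue_split n x (r : int) : (x %% NN n)%Z = r ->
  exists z, x = z + r /\
    (z <= - NN n \/ z = 0 \/ z = NN n \/ NN n + NN n <= z).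
Proof.
move=> <-; exists ((x %/ NN n)%Z * NN n); split; first exact: divz_eq.
have := NN_gt0 n; move: (x %/ NN n)%Z => q; move: (NN n) => N N0.
have [->|q0] := eqVneq q 0; first by right; left; lia.
have [->|q1] := eqVneq q 1; first by right; right; left; lia.
have [q2|q2] := leP 2 q; [do 3!right|left]; nia.
Qed.

Lemma lowP t n k e : low t n k e -> exists r z,
  [/\ r \in low_residues t n k, (e %% NN n)%Z = r, e = z + r &
      z <= - NN n \/ z = 0 \/ z = NN n \/ NN n + NN n <= z].
Proof.
by move=> he; have [z [ez zE]] := residue_split (erefl (e %% NN n)%Z); exists (e %% NN n)%Z, z.
Qed.

(** By flushness all entries of the runner above a gap are gaps. The lower bound on x is one period
    weaker than expected, since the runner has no entry in between; this matches the bound b - N of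
    [peels_gap]. *)
Lemma gap_up n a R (q r x : int) : good n a R -> a (q * NN n + r) = false ->
  0 <= r < NN n -> (x %% NN n)%Z = r -> q * NN n + r - NN n < x -> a x = false.
Proof.
move=> ga h rN xr qx.
have xE := divz_eq x (NN n); rewrite xr in xE; rewrite xE in qx *.
move: (x %/ NN n)%Z qx => m qx.
have qm : q <= m.
  have : (q - 1) * NN n < m * NN n by rewrite mulrBl mul1r; lia.
  by rewrite ltr_pM2r //; lia.
apply: contraFF h => am.
have -> : q * NN n + r = m * NN n + r - (`|m - q|%N)%:Z * NN n.
  have -> : (`|m - q|%N)%:Z = m - q by lia.
  by rewrite mulrBl; lia.
elim: `|m - q|%N => [|i IH]; first by rewrite mul0r subr0.
have -> : i.+1%:Z * NN n = i%:Z * NN n + NN n by rewrite -addn1 PoszD mulrDl mul1r.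
by rewrite opprD addrA; apply: (good_sub ga).
Qed.

Section Peels.

Variables (t : affine_type) (n : nat) (w : int -> int) (b : int).
Hypotheses (hn : (min_rank t <= n)%N) (mw : mirrored n w)
  (hlow : least t n w b).

Let a := abacus n w.
Let ga : good n a (radius n w) := abacus_good mw.

Lemma mirror_gap p : a p -> a (NN n + NN n - p) = false.
Proof.
by move=> ap; rewrite (good_mirror ga) ?ap //; apply: (good_entry ga).
Qed.

Lemma peels_middle k : (0 < k <= n)%N -> (k < n)%N || ~~ right_fork t ->
  b < NN n + NN n -> a (b - 1) = false ->
  b = NN n + k%:Z + 1 \/ b = NN n + NN n - k%:Z ->
  peels t n k w b.
Proof.
move=> k0 kn b2 b1 hb; have [ab tb hl] := hlow.
have hk : (k <= n)%N by lia.
have NE := NNE n; have ht := threshold_bounds t n; have n2 := rank_bound hn.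
have [sh lr] : shift t n k = 1 /\
    low_residues t n k = [:: k%:Z; NN n - k%:Z - 1].
  have [[kE]|[kE]|[kE rf]|[_ _ _ -> ->] //] := low_caseP hn hk.
  - by rewrite kE in k0.
  - by rewrite kE in k0.
  - by rewrite kE rf ltnn in kn.
(* Both values of b lead to the same pair of low residues, those of b - 1 and -b. The runner of b -
   1 has a gap at b - 1 by hypothesis, and that of -b has one at 2N - b by reflection. *)
have inl r : r \in low_residues t n k -> r = b - NN n - 1 \/ r = NN n + NN n - b.
  by rewrite lr !inE; case: hb => ->; lia.
have lb : low t n k (b - 1).
  rewrite /low lr -(modzMDl (-1)) modz_small; first by rewrite !inE; lia.
  by case: hb => ->; lia.
have mb : a (NN n + NN n - b) = false by apply: mirror_gap.
have L x : low t n k x -> b - NN n <= x -> ~~ abacus n w x.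
  move=> /lowP[r [z [/inl rE xr _ _]]] bx; apply/negbT; case: rE => rE.
    apply: (gap_up (q := 1) ga _ _ xr); rewrite rE; try lia.
    by have -> : 1 * NN n + (b - NN n - 1) = b - 1 by lia.
  apply: (gap_up (q := 0) ga _ _ xr); rewrite rE; try lia.
  by rewrite mul0r add0r.
have sup x : x - 1 <= gen t n k x <= x + 1.
  by case: (genP x hn hk) => // _; rewrite ?sh; lia.
split.
- by rewrite sh.
- exact: L.
- move=> e x ae be ax xb; rewrite lt_neqAle (inj_eq (inv_inj (genK hn hk))).
  by have := sup x; have := sup (e - NN n); lia.
- by move=> e ae be; have := sup e; lia.
- move=> e ae et; rewrite leNgt; apply/negP => se; move: se.
  have := entryP (good_entry ga ae).
  case: (genP e hn hk) => [le|le|le _]; try by rewrite ?sh; lia.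
  by rewrite sh => he se; case/negP: (L e le ltac:(lia)).
- move=> e ae be en; case: (genP e hn hk) => // [le|le].
    by case/negP: (L e le ltac:(lia)).
  move: le; rewrite sh => /lowP[r [z [/inl rE _ ez zE]]]; lia.
- move=> e ae be en se; exfalso; move: se.
  case: (genP e hn hk) => [le|/lowP|]; rewrite ?sh; try lia.
  by case=> r [z [/inl rE _ ez zE]]; lia.
Qed.

Lemma peels_zero : ~~ left_fork t -> b = NN n + 1 -> peels t n 0 w b.
Proof.
move=> lf hb; have [ab tb hl] := hlow.
have NE := NNE n; have tE : threshold t n = NN n.
  by move: lf; rewrite /threshold; case: (t) => //= _; rewrite addr0.
have n2 := rank_bound hn.
have sh : shift t n 0 = 2 by rewrite /shift /= (negbTE lf).
have lr : low_residues t n 0 = [:: NN n - 1] by rewrite /low_residues /= (negbTE lf).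
have inl r : r \in low_residues t n 0 -> r = NN n - 1 by rewrite lr inE => /eqP.
have mb : a (NN n - 1) = false.
  by have := mirror_gap ab; rewrite hb; have -> : NN n + NN n - (NN n + 1) = NN n - 1 by lia.
have L x : low t n 0 x -> b - NN n <= x -> ~~ abacus n w x.
  move=> /lowP[r [z [/inl rE xr _ _]]] bx; apply/negbT.
  apply: (gap_up (q := 0) ga _ _ xr); rewrite rE; try lia.
  by rewrite mul0r add0r.
split.
- rewrite sh /low lr hb -(modzMDl 0) mul0r add0r modz_small; last lia.
  by rewrite inE; lia.
- exact: L.
- move=> e x ae be ax xb; have := entryP (good_entry ga ax).
  have := entryP (good_entry ga ae).
  case: (genP x hn (leq0n n)) => [/lowP|/lowP|_ _];
    case: (genP (e - NN n) hn (leq0n n)) => [/lowP|/lowP|_ _];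
    rewrite ?sh; (try case=> r [z [/inl rE _ ez zE]]);
    (try case=> r' [z' [/inl rE' _ ez' zE']]); lia.
- move=> e ae be; case: (genP e hn (leq0n n)) => [/lowP|/lowP|_ _];
    rewrite ?sh; (try case=> r [z [/inl rE _ ez zE]]); lia.
- move=> e ae et; case: (genP e hn (leq0n n)) => [le|/lowP|_ _];
    rewrite ?sh; (try case=> r [z [/inl rE _ ez zE]]); try lia.
  have [eb|eb] := leP (b - NN n) e; first by case/negP: (L e le eb).
  by lia.
- move=> e ae be en; case: (genP e hn (leq0n n)) => [le|/lowP|_ _];
    rewrite ?sh; (try case=> r [z [/inl rE _ ez zE]]); try lia.
  by case/negP: (L e le ltac:(lia)).
- move=> e ae be en se; exfalso; move: se.
  case: (genP e hn (leq0n n)) => [le|/lowP|_ _]; rewrite ?sh;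
    (try case=> r [z [/inl rE _ ez zE]]); lia.
Qed.

End Peels.

Section ForkPeels.

Variables (t : affine_type) (n : nat) (w : int -> int) (b : int).
Hypotheses (hn : (min_rank t <= n)%N) (mw : mirrored n w)
  (hlow : least t n w b).

Let ga : good n (abacus n w) (radius n w) := abacus_good mw.

Lemma left_fork_data : left_fork t ->
  [/\ (3 <= n)%N, threshold t n = NN n + 1, shift t n 0 = 3 &
      forall r, r \in low_residues t n 0 -> r = NN n - 2 \/ r = NN n - 1].
Proof.
move=> lf; have [n2 [n3 _]] := rank_bound hn; rewrite lf in n3.
rewrite /low_residues /shift /= lf; split=> //; first exact: n3.
  by move: lf; rewrite /threshold; case: (t).
by move=> r; rewrite !inE => /orP[/eqP->|/eqP->]; [left|right].
Qed.

Lemma right_fork_data : right_fork t ->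
  [/\ (3 <= n)%N, shift t n n = 2 &
      low_residues t n n = [:: n%:Z - 1; n%:Z]].
Proof.
move=> rf; have [n2 [n3 _]] := rank_bound hn; rewrite rf orbT in n3.
have n0 : (n == 0%N) = false by lia.
by rewrite /low_residues /shift n0 eqxx rf; split=> //; exact: n3.
Qed.

(** s_0^D takes N + 1 and N + 2 together to N - 2 and N - 1, which are gaps by reflection of these
    two beads. *)
Lemma peels_left_low : left_fork t -> b = NN n + 2 -> abacus n w (NN n + 1) ->
  peels t n 0 w b.
Proof.
move=> lf hb a1; have [ab tb hl] := hlow.
have [n3 tE sh inl] := left_fork_data lf; have NE := NNE n.
have m1 : abacus n w (NN n - 1) = false.
  by have := mirror_gap mw a1; have -> : NN n + NN n - (NN n + 1) = NN n - 1 by lia.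
have m2 : abacus n w (NN n - 2) = false.
  have := mirror_gap mw ab; rewrite hb.
  by have -> : NN n + NN n - (NN n + 2) = NN n - 2 by lia.
have L x : low t n 0 x -> b - NN n <= x -> ~~ abacus n w x.
  move=> /lowP[r [z [/inl rE xr _ _]]] bx; apply/negbT.
  by apply: (gap_up (q := 0) ga _ _ xr); case: rE => ->; rewrite ?mul0r ?add0r; lia.
split.
- rewrite sh /low /low_residues /= lf hb -(modzMDl 0) mul0r add0r modz_small; last lia.
  by rewrite !inE; lia.
- exact: L.
- move=> e x ae be ax xb; have [x0 _] := entryP (good_entry ga ax).
  have hx : gen t n 0 x <= 2.
    case: (genP x hn (leq0n n)) => [/lowP|/lowP|_ _]; rewrite ?sh; try lia.
    by case=> r [z [/inl rE _ ez zE]]; lia.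
  case: (genP (e - NN n) hn (leq0n n)) => [/lowP|/lowP|_ _]; rewrite ?sh; try lia.
  by case=> r [z [/inl rE _ ez zE]]; lia.
- move=> e ae be; case: (genP e hn (leq0n n)) => [/lowP|/lowP|_ _]; rewrite ?sh; try lia.
  by case=> r [z [/inl rE _ ez zE]]; lia.
- move=> e ae et; rewrite leNgt; apply/negP => se; move: se.
  case: (genP e hn (leq0n n)) => [le|_|_ _]; rewrite ?sh; try lia.
  have [eb|eb] := leP (b - NN n) e; first by case/negP: (L e le eb).
  by lia.
- move=> e ae be en; case: (genP e hn (leq0n n)) => // [le|/lowP].
    by case/negP: (L e le ltac:(lia)).
  by rewrite sh => -[r [z [/inl rE _ ez zE]]]; lia.
- move=> e ae be en se; exfalso; move: se.
  case: (genP e hn (leq0n n)) => [_|/lowP|_ _]; rewrite ?sh; try lia.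
  by case=> r [z [/inl rE _ ez zE]]; lia.
Qed.

Lemma peels_left_high : left_fork t -> b = NN n + NN n + 1 ->
  abacus n w (NN n + 1) -> peels t n 0 w b.
Proof.
move=> lf hb a1; have [ab tb hl] := hlow.
have [n3 tE sh inl] := left_fork_data lf; have NE := NNE n.
have m1 : abacus n w (NN n - 1) = false.
  by have := mirror_gap mw a1; have -> : NN n + NN n - (NN n + 1) = NN n - 1 by lia.
have g1 : abacus n w (NN n + (NN n - 1)) = false by apply: hl; lia.
have g2 : abacus n w (NN n + (NN n - 2)) = false by apply: hl; lia.
have g3 : abacus n w (NN n + 2) = false by apply: hl; lia.
have L x : low t n 0 x -> b - NN n <= x -> ~~ abacus n w x.
  move=> /lowP[r [z [/inl rE xr _ _]]] bx; apply/negbT.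
  by apply: (gap_up (q := 1) ga _ _ xr); case: rE => ->; rewrite ?mul1r //; lia.
split.
- rewrite sh /low /low_residues /= lf hb -(modzMDl (-1)) modz_small; rewrite ?inE; lia.
- exact: L.
- move=> e x ae be ax xb; have [x0 [xN _]] := entryP (good_entry ga ax).
  have hx : gen t n 0 x <= NN n + 1.
    have x1 : x != NN n - 1 by apply: contraTneq ax => ->; rewrite m1.
    case: (genP x hn (leq0n n)) => [/lowP|/lowP|_ _]; rewrite ?sh; try lia.
  (* N + 2 is the one entry above N + 1 that s_0^D would lower too far, to N - 1; a bead at 2N + 2
     would force one at N + 2. *)
  have he : e - NN n != NN n + 2.
    by apply: contraTneq (good_sub ga ae) => ->; rewrite g3.
  case: (genP (e - NN n) hn (leq0n n)) => [/lowP|/lowP|_ _]; rewrite ?sh; try lia.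
  by case=> r [z [/inl rE _ ez zE]]; lia.
- move=> e ae be; case: (genP e hn (leq0n n)) => [/lowP|/lowP|_ _]; rewrite ?sh; lia.
- move=> e ae et; rewrite leNgt; apply/negP => se; move: se.
  have [x0 [xN _]] := entryP (good_entry ga ae).
  have e1 : e != NN n - 1 by apply: contraTneq ae => ->; rewrite m1.
  case: (genP e hn (leq0n n)) => [/lowP|_|_ _]; rewrite ?sh; try lia.
  by case=> r [z [/inl rE _ ez zE]]; lia.
- move=> e ae be en; exfalso; lia.
- move=> e ae be en se; exfalso; move: se.
  case: (genP e hn (leq0n n)) => [_|/lowP|_ _]; rewrite ?sh; try lia.
Qed.

Lemma peels_right_low : right_fork t -> b = NN n + n%:Z + 1 -> peels t n n w b.
Proof.
move=> rf hb; have [ab tb hl] := hlow; have ht := threshold_bounds t n.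
have [n3 sh lr] := right_fork_data rf; have NE := NNE n.
have inl r : r \in low_residues t n n -> r = n%:Z - 1 \/ r = n%:Z.
  by rewrite lr !inE => /orP[/eqP->|/eqP->]; [left|right].
have g1 : abacus n w (NN n + (n%:Z - 1)) = false by apply: hl; lia.
have g2 : abacus n w (NN n + n%:Z) = false by apply: hl; lia.
have m0 : abacus n w n%:Z = false.
  by have := mirror_gap mw ab; have -> : NN n + NN n - b = n%:Z by lia.
have L x : low t n n x -> b - NN n <= x -> ~~ abacus n w x.
  move=> /lowP[r [z [/inl rE xr _ _]]] bx; apply/negbT.
  by apply: (gap_up (q := 1) ga _ _ xr); case: rE => ->; rewrite ?mul1r //; lia.
split.
- rewrite sh /low lr hb -(modzMDl (-1)) modz_small; rewrite ?inE; lia.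
- exact: L.
- move=> e x ae be ax xb.
  have xn : x != n%:Z by apply: contraTneq ax => ->; rewrite m0.
  have hx : gen t n n x <= n%:Z + 1.
    by case: (genP x hn (leqnn n)) => [/lowP|/lowP|_ _]; rewrite ?sh; lia.
  (* Here n + 2 is the delicate position: it is lowered to n. But a bead at N + n + 2 makes n - 1 a
     gap, so x is then at most n - 2 and stays there or below. *)
  have [he|he] : e - NN n = n%:Z + 2 \/ n%:Z + 3 <= e - NN n by lia.
    have x1 : x != n%:Z - 1.
      apply: contraTneq ax => ->; have := mirror_gap mw ae.
      have -> : NN n + NN n - e = n%:Z - 1 by lia.
      by move=> ->.
    have hx' : gen t n n x <= n%:Z - 2.
      case: (genP x hn (leqnn n)) => [/lowP|/lowP|_ _]; rewrite ?sh; try lia.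
      by case=> r [z [/inl rE _ ez zE]]; lia.
    by case: (genP (e - NN n) hn (leqnn n)) => [/lowP|/lowP|_ _]; rewrite ?sh; lia.
  case: (genP (e - NN n) hn (leqnn n)) => [/lowP|/lowP|_ _]; rewrite ?sh; try lia.
  by case=> r [z [/inl rE _ ez zE]]; lia.
- by move=> e ae be; case: (genP e hn (leqnn n)) => [/lowP|/lowP|_ _]; rewrite ?sh; lia.
- move=> e ae et; rewrite leNgt; apply/negP => se; move: se.
  case: (genP e hn (leqnn n)) => [/lowP|_|_ _]; rewrite ?sh; try lia.
  by case=> r [z [/inl rE _ ez zE]]; lia.
- by move=> e ae be en; exfalso; lia.
- move=> e ae be en se; split=> //; move: se.
  by case: (genP e hn (leqnn n)) => [/lowP|/lowP|_ _]; rewrite ?sh; lia.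
Qed.

Lemma peels_right_high : right_fork t -> b = NN n + n%:Z + 2 -> peels t n n w b.
Proof.
move=> rf hb; have [ab tb hl] := hlow; have ht := threshold_bounds t n.
have [n3 sh lr] := right_fork_data rf; have NE := NNE n.
have inl r : r \in low_residues t n n -> r = n%:Z - 1 \/ r = n%:Z.
  by rewrite lr !inE => /orP[/eqP->|/eqP->]; [left|right].
have g1 : abacus n w (NN n + (n%:Z - 1)) = false by apply: hl; lia.
have g2 : abacus n w (NN n + n%:Z) = false by apply: hl; lia.
have L x : low t n n x -> b - NN n <= x -> ~~ abacus n w x.
  move=> /lowP[r [z [/inl rE xr _ _]]] bx; apply/negbT.
  by apply: (gap_up (q := 1) ga _ _ xr); case: rE => ->; rewrite ?mul1r //; lia.
split.
- rewrite sh /low lr hb -(modzMDl (-1)) modz_small; rewrite ?inE; lia.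
- exact: L.
- move=> e x ae be ax xb.
  have hx : gen t n n x <= n%:Z + 2.
    case: (genP x hn (leqnn n)) => [/lowP|/lowP|_ _]; rewrite ?sh; try lia.
    by case=> r [z [/inl rE _ ez zE]]; lia.
  case: (genP (e - NN n) hn (leqnn n)) => [/lowP|/lowP|_ _]; rewrite ?sh; try lia.
  by case=> r [z [/inl rE _ ez zE]]; lia.
- by move=> e ae be; case: (genP e hn (leqnn n)) => [/lowP|/lowP|_ _]; rewrite ?sh; lia.
- move=> e ae et; rewrite leNgt; apply/negP => se; move: se.
  case: (genP e hn (leqnn n)) => [/lowP|_|_ _]; rewrite ?sh; try lia.
  by case=> r [z [/inl rE _ ez zE]]; lia.
- by move=> e ae be en; exfalso; lia.
- move=> e ae be en se; exfalso; move: se.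
  by case: (genP e hn (leqnn n)) => [/lowP|/lowP|_ _]; rewrite ?sh; lia.
Qed.

End ForkPeels.

(** * Contents of the live rows and the reference row *)

Lemma rk_succ n : rk n (NN n + 1) = 0.
Proof.
by rewrite /rk ifT ?cntS // /cnt ?subrr ?/entry ?dvdzz //=; lia.
Qed.

Lemma rk_small n b : NN n < b <= NN n + NN n -> rk n b = b - NN n - 1.
Proof.
move=> hb; have := @rkE n (NN n) b; have := @rkE n (NN n) (NN n + 1).
rewrite rk_succ => h1 h2; have e1 := @cnt_cat (entry n) (NN n) (NN n + 1) b.
have e2 := @cnt_all (entry n) (NN n + 1) b.
have : forall e, NN n + 1 <= e < b -> entry n e.
  by move=> e he; apply: (@entry_mul n 1); lia.
move=> /e2; lia.
Qed.

(** One less than the formula of [rk_small] would give, since 2N is not an entry. *)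
Lemma rk_large n : rk n (NN n + NN n + 1) = NN n - 1.
Proof.
have N0 := NN_gt0 n; have h1 := @rk_small n (NN n + NN n).
have h2 := @rkE n (NN n) (NN n + NN n).
have h3 := @rkE n (NN n) (NN n + NN n + 1).
have h4 := @cntS (entry n) (NN n) (NN n + NN n).
have : entry n (NN n + NN n) = false by rewrite /entry dvd_addN dvdzz.
by move=> h5; rewrite h5 in h4; lia.
Qed.

Lemma filter_sorted_gt (s : seq int) (M : int) : sorted >%R s ->
  exists2 s', s = [seq e <- s | M < e] ++ s' & all (fun e => e <= M) s'.
Proof.
elim: s => [|x s IH] hp; first by exists [::].
have [s' es hs'] := IH (path_sorted hp).
have hx : all (fun y => y < x) s.
  by apply: (order_path_min _ hp) => a b c /=; lia.
rewrite /=; case: ifP => Mx; first by exists s'; rewrite //= -es.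
have h0 : all (fun e => e <= M) s by apply: sub_all hx => y /=; lia.
exists (x :: s); last by rewrite /= h0 andbT; lia.
rewrite (_ : filter _ _ = [::]) //; apply/eqP; rewrite -[_ == _]negbK -has_filter.
by apply/hasPn => y /(allP h0); lia.
Qed.

Section CoreRows.

Variables (t : affine_type) (n : nat) (w : int -> int).
Hypotheses (hn : (min_rank t <= n)%N) (mw : mirrored n w).

Let Q := live_beads t n w.

Lemma live_prefix : exists2 s, beadsR (abacus n w) (radius n w) = Q ++ s &
  all (fun e => e <= threshold t n) s.
Proof.
rewrite /Q /live_beads beads_descE.
exact: filter_sorted_gt (beadsR_sorted _ _).
Qed.

Lemma row_len_live i : (i < size Q)%N ->
  (row_len (core n w) i.+1)%:Z = i.+1%:Z + rk n (nth 0 Q i).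
Proof.
have [s es _] := live_prefix => hi.
by rewrite coreE (row_len_core (abacus_good mw)) es ?nth_cat ?hi // size_cat; lia.
Qed.

Lemma rk_live e : e \in Q -> (ref_diag t)%:Z <= rk n e.
Proof.
rewrite mem_live // => /andP[ae he]; have ee := good_entry (abacus_good mw) ae.
have [r0|r1] : ref_diag t = 0%N \/ ref_diag t = 1%N.
- by case: (t); [left|right|left|right].
- rewrite r0; move: he; rewrite /threshold r0 addr0 => he.
  have [->|ne] := eqVneq e (NN n + 1); first by rewrite rk_succ.
  suff : rk n (NN n + 1) < rk n e by rewrite rk_succ => /ltW.
  apply: lt_rk; last lia.
  by apply: (@entry_mul n 1); have := NNE n; have := rank_bound hn; lia.
rewrite r1; move: he; rewrite /threshold r1 => he.
suff : rk n (NN n + 1) < rk n e by rewrite rk_succ.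
apply: lt_rk => //.
by apply: (@entry_mul n 1); have := NNE n; have := rank_bound hn; lia.
Qed.

Lemma rk_dead e : abacus n w e -> e <= threshold t n -> rk n e < (ref_diag t)%:Z.
Proof.
move=> ae he; have ee := good_entry (abacus_good mw) ae.
have rN : rk n (NN n) = 0 by rewrite /rk lexx /cnt subrr.
have [eN|eN] := ltP e (NN n); first by have := lt_rk ee eN; lia.
have := entryP ee; move: he; rewrite /threshold => he [_ [neN _]].
have e1 : e = NN n + 1 by case: t he => /=; lia.
by rewrite e1 rk_succ; case: t he => /=; lia.
Qed.

Lemma row_len_dead i : (size Q <= i)%N ->
  (row_len (core n w) i.+1 < i.+1 + ref_diag t)%N.
Proof.
move=> hi; have gw := abacus_good mw; have [s es hs] := live_prefix.
have [iB|iB] := ltnP i (size (beadsR (abacus n w) (radius n w))); last first.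
  by rewrite coreE row_len_core0.
have := row_len_core gw iB; rewrite -coreE.
have := mem_nth 0 iB; rewrite mem_beadsR => /andP[ab _].
have : nth 0 (beadsR (abacus n w) (radius n w)) i <= threshold t n.
  move: iB; rewrite es size_cat nth_cat (leq_gtF hi) => iB.
  by apply: (allP hs); apply: mem_nth; rewrite ltn_subLR.
move=> /(rk_dead ab); move: (rk n _) (row_len _ _) => r l; lia.
Qed.

Lemma ref_rowE : ref_row t (core n w) = size Q.
Proof.
have rP i : (0 < i)%N -> (i + ref_diag t <= row_len (core n w) i)%N = (i <= size Q)%N.
  case: i => // i _; case: ltnP => hi; last by have := row_len_dead hi; lia.
  have := row_len_live hi; have := rk_live (mem_nth 0 hi).
  by move: (rk n _) (row_len _ _) => r l; lia.
have Qm : (size Q <= size (core n w))%N.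
  case hQ: (size Q) => [|d] //; rewrite ltnNge; apply/negP => h.
  have := rP d.+1 isT; rewrite hQ leqnn /row_len nth_default; last by [].
  by lia.
rewrite /ref_row (@eq_in_count _ _ (fun i => i <= size Q)%N); last first.
  by move=> i; rewrite mem_iota => hi; apply: rP; lia.
rewrite -size_filter -(subnKC Qm) iotaD filter_cat.
rewrite (_ : filter _ (iota 1 _) = iota 1 (size Q)); last first.
  by apply/all_filterP/allP => i; rewrite mem_iota; lia.
rewrite (_ : filter _ _ = [::]) ?cats0 ?size_iota //.
apply/eqP; rewrite -[_ == _]negbK -has_filter; apply/hasPn => i.
by rewrite mem_iota; lia.
Qed.

Lemma core_nil : core n w = [::] -> Q = [::].
Proof.
move=> c0; case hQ: Q => [|e s] //.
have := @row_len_live 0; have := @rk_live (nth 0 Q 0).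
by rewrite hQ c0 /= inE eqxx => /(_ isT) h1 /(_ isT) h2; move: h2; rewrite /row_len /=; lia.
Qed.

(** The map e -> w^-1(e) - N sends the beads above N bijectively to the positions i <= 0 with w(i)
    >= 1, whose number is even. The live beads are all of these beads except N + 1. *)
Lemma even_beads : left_fork t -> in_group t n w ->
  odd (size Q) = abacus n w (NN n + 1).
Proof.
move=> lf [_ hl _]; have [s [us sP so]] := hl lf.
have [g [wK gK gN go]] := mirrored_inv mw; have gw := abacus_good mw.
have gB e : g (e - NN n) = g e - NN n.
  by apply: (can_inj wK); rewrite gK -{2}(subrK (NN n) e) gN addrK gK.
pose P := [seq e <- beads_desc n w | NN n < e].
have uB : uniq (beads_desc n w).
  rewrite beads_descE; apply: (sorted_uniq _ _ (beadsR_sorted _ _)) => [x y z|x] /=; lia.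
have uP : uniq P by apply: filter_uniq.
have mP e : (e \in P) = abacus n w e && (NN n < e).
  rewrite mem_filter beads_descE mem_beadsR andbC -andbA.
  case ae: (abacus n w e) => //=; apply/andb_idl => he.
  have : e <= radius n w.
    by rewrite leNgt; apply: contraTN ae => h; rewrite (good_high gw).
  by have := NN_gt0 n; lia.
have sizeP : size P = size s.
  rewrite -(size_map (fun e => g e - NN n) P); apply/perm_size/uniq_perm => // [|i].
    rewrite map_inj_uniq // => x y /(can_inj (subrK _)); exact: (can_inj gK).
  rewrite sP; apply/mapP/idP => [[e]|/andP[i0 wi]].
    rewrite mP (abacusE _ mw wK gK) => /andP[/andP[_ ge] Ne] ->.
    by rewrite -[w _](congr1 w (gB e)) gK; lia.
  have wp : 0 < w i by lia.
  exists (w i + NN n); last by rewrite gN wK addrK.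
  rewrite mP (abacusE _ mw wK gK) gN wK dvd_addN dvd_mirrored //.
  have hd : (NN n %| i)%Z = false.
    by apply: contraTF wp => /dvdzP[m im]; rewrite im mirrored_mul // -im; lia.
  have : i != 0 by apply: contraFneq hd => ->; apply/dvdzP; exists 0; rewrite mul0r.
  by rewrite hd /=; lia.
have : size P = (size Q + abacus n w (NN n + 1)%R)%N.
  rewrite /P /Q /live_beads !size_filter.
  have -> : threshold t n = NN n + 1 by move: lf; rewrite /threshold; case: (t).
  have -> : (abacus n w (NN n + 1) : nat) = count (pred1 (NN n + 1)) (beads_desc n w).
    rewrite count_uniq_mem //; have := mP (NN n + 1).
    by rewrite mem_filter ltrDl ltr01 andbT /= => <-.
  rewrite -count_predUI [X in _ = (_ + X)%N](_ : _ = 0%N) ?addn0.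
    by apply: eq_count => i /=; lia.
  by apply/eqP; rewrite -leqn0 leqNgt -has_count; apply/hasPn => i _ /=; lia.
rewrite sizeP => h; move: so; rewrite h oddD.
by case: (abacus _ _ _); case: (odd _).
Qed.

End CoreRows.

(** * Residues *)

(* The residue r_i when the box B_i lies in row d and on diagonal c. *)
Definition peel_index (t : affine_type) (n d c : nat) : nat :=
  if left_fork t && (c == 1%N) then if odd d then 0%N else 1%N
  else if left_fork t && (c == n.*2) then 0%N
  else if right_fork t && (c == n.+1) then n
  else if (c <= n)%N then c else (n.*2 - c)%N.

Lemma diag_mod_box n d c : (0 < n)%N ->
  diag_mod n (d, (d + c)%N) = (c %% n.*2)%N.
Proof.
move=> n0; rewrite /diag_mod /diag /=.
have -> : (d + c)%N%:Z - d%:Z = c%:Z by lia.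
by rewrite modz_nat.
Qed.

(** The box is the last of its row, so in [stair_residues] the row ends at the very cell considered:
    only the residue of c_p with p = q + 1 matters, which is x, y or both for p = 1, 2, 3. *)
Lemma residues_box t n lam d c : (min_rank t <= n)%N ->
  row_len lam d = (d + c)%N -> (ref_diag t <= c)%N ->
  (c < n.*2)%N || left_fork t && (c == n.*2) ->
  residues t n lam (d, (d + c)%N) =
  if right_fork t && (c == n.+1) then [:: n.-1; n]
  else [:: peel_index t n d c].
Proof.
move=> hn hr hc cn; have [n2 [n3 n4]] := rank_bound hn.
rewrite /residues diag_mod_box; last lia.
have absd : `|diag (d, (d + c)%N)|%N = c by rewrite /diag /=; lia.
rewrite absd /peel_index.
have [c1|c1] := eqVneq c 1%N.
  rewrite {}c1 in hr hc cn absd *.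
  have -> : (1 %% n.*2)%N = 1%N by rewrite modn_small; lia.
  have -> : (1 == n.+1)%N = false by lia.
  rewrite !inE !andbT !andbF /=.
  case lf: (left_fork t) => /=.
    rewrite /main_descalator_residue /=; congr [:: _].
    rewrite ifF; last lia.
    (* The box is (d, d + 1), and 2d + 1 is 3 modulo 4 exactly if d is odd. *)
    case hd: (odd d).
      rewrite ifF //; apply/negbTE/eqP => h.
      have : (d + (d + 1) = 3 %[mod 4])%N by rewrite -[d]odd_double_half hd /=; lia.
      by rewrite h.
    have : (d + (d + 1) = 1 %[mod 4])%N by rewrite -[d]odd_double_half hd /=; lia.
    by move/eqP->.
  rewrite ifF; last first.
    by apply/negP => /andP[rf]; rewrite lf rf in n3; lia.
  rewrite /fixed_residue diag_mod_box; last lia.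
  by congr [:: _]; rewrite modn_small; [do !case: ifP; lia|lia].
have [c2|c2] := eqVneq c n.*2.
  rewrite {}c2 in hr hc cn absd c1 *.
  have lf : left_fork t by move: cn; rewrite ltnn => /andP[].
  rewrite lf modnn /= ?inE ?eqxx /=.
  have -> : (n.*2 == n.+1)%N = false by lia.
  rewrite andbF; have -> : (n.*2 <= 1)%N = false by lia.
  rewrite /stair_residue /= modn_small; last lia.
  have -> : (d < d + n.*2)%N by lia.
  by rewrite hr; have -> : (d + n.*2)%N%:Z - (d + n.*2)%N%:Z + 1%N%:Z + 1 = 2%N%:Z by lia.
have cs : (c < n.*2)%N by move: cn; rewrite (negbTE c2) andbF orbF.
rewrite !andbF modn_small // !inE.
have c0 : left_fork t -> (c == 0%N) = false by case: (t) hc => //= ? _; lia.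
rewrite (negbTE c1) /=.
case lf: (left_fork t && _) => /=.
  have [lf' /orP[c0'|/eqP cE]] := andP lf; first by rewrite c0 in c0'.
  have -> : (c <= 1)%N = false by lia.
  have rE : right_fork t && (c == n.+1) = false.
    by apply/negP => /andP[rf cn']; rewrite lf' rf in n4; lia.
  rewrite rE /stair_residue /=.
  have -> : (d < d + c)%N by lia.
  have -> : (c.+1 %% n.*2)%N = 0%N by rewrite cE prednK ?modnn; lia.
  rewrite hr; have -> : (d + c)%N%:Z - (d + c)%N%:Z + 0%N%:Z + 1 = 1%N%:Z by lia.
  rewrite /=; congr [:: _].
  by case: ifP; lia.
case rf: (right_fork t) => /=.
  have rn3 : (3 <= n)%N by apply: n3; rewrite rf orbT.
  case: (eqVneq c n.+1) => [cE|cE].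
    rewrite cE !orbT /stair_residue /=.
    have -> : (d < d + n.+1)%N by lia.
    have -> : (n.+2 - n)%N = 2%N by lia.
    rewrite -cE hr; have -> : (d + c)%N%:Z - (d + c)%N%:Z + 2%N%:Z + 1 = 3%N%:Z by lia.
    by [].
  rewrite orbF; case: (eqVneq c n.-1) => [cE'|cE'].
    rewrite /= /stair_residue /=.
    have -> : (d < d + c)%N by lia.
    have -> : (c.+1 - n)%N = 0%N by lia.
    rewrite hr; have -> : (d + c)%N%:Z - (d + c)%N%:Z + 0%N%:Z + 1 = 1%N%:Z by lia.
    by rewrite /=; congr [:: _]; case: ifP; lia.
  rewrite /=; case: (eqVneq c n) => [cE''|cE''].
    rewrite /stair_residue /=.
    have -> : (d < d + c)%N by lia.
    have -> : (c.+1 - n)%N = 1%N by lia.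
    rewrite hr; have -> : (d + c)%N%:Z - (d + c)%N%:Z + 1%N%:Z + 1 = 2%N%:Z by lia.
    by rewrite /=; congr [:: _]; case: ifP; lia.
  rewrite /fixed_residue diag_mod_box; last lia.
  by rewrite modn_small.
rewrite /fixed_residue diag_mod_box; last lia.
by rewrite modn_small.
Qed.

Section PeelResidue.

Variables (t : affine_type) (n : nat) (w : int -> int) (Q : seq int) (b : int).
Hypotheses (hn : (min_rank t <= n)%N) (gw : in_group t n w)
  (hQ : live_beads t n w = rcons Q b).

Let d := (size Q).+1.
Let c := `|rk n b|%N.
Let mw : mirrored n w := let: And3 mw _ _ := gw in mw.

Let hlow : least t n w b := least_live mw hQ.

Lemma rk_least : rk n b = c%:Z /\
  (b < NN n + NN n /\ c%:Z = b - NN n - 1 \/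
   [/\ left_fork t, b = NN n + NN n + 1, c = n.*2 & abacus n w (NN n + 1)]).
Proof.
have NE := NNE n; have [ab tb hl] := hlow; have ht := threshold_bounds t n.
case: (least_bound mw hlow) => [hb|[lf hb a1]].
  by have := @rk_small n b; rewrite /c; split; [lia|left; lia].
rewrite /c hb rk_large; split; first lia.
by right; split=> //; lia.
Qed.

Lemma row_len_least : row_len (core n w) d = (d + c)%N.
Proof.
have := @row_len_live t n w hn mw (size Q); rewrite hQ size_rcons nth_rcons ltnn eqxx.
by rewrite (rk_least).1 => /(_ (ltnSn _)); rewrite -/d; lia.
Qed.

Lemma end_boxE : end_box t (core n w) = (d, (d + c)%N).
Proof.
by rewrite /end_box (ref_rowE hn mw) hQ size_rcons row_len_least.
Qed.

Lemma content_bounds : (ref_diag t <= c)%N /\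
  (c < n.*2)%N || left_fork t && (c == n.*2).
Proof.
have [ab tb _] := hlow; have NE := NNE n; move: tb; rewrite /threshold.
have rt : (ref_diag t <= 1)%N by case: (t).
have [n2 _] := rank_bound hn.
case: rk_least => _ [[hb hc]|[-> _ -> _]] => tb; last by rewrite eqxx orbT; lia.
by move: hc; move: c => x hc; lia.
Qed.

Lemma peel_residueE r : peel_residue t n (core n w) r <-> r = peel_index t n d c.
Proof.
have [n2 [n3 n4]] := rank_bound hn; have [hc hc'] := content_bounds.
rewrite /peel_residue end_boxE (residues_box hn row_len_least hc hc').
case rc: (right_fork t && (c == n.+1)); cbv zeta.
  rewrite !inE !eqxx !orbT /= /peel_index rc.
  have [rf /eqP cE] := andP rc.
  rewrite ifF; last by lia.
  by rewrite ifF //; lia.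
rewrite !inE; have -> : (n == peel_index t n d c) && (n.-1 == peel_index t n d c) = false.
  by lia.
by split=> [/eqP|->].
Qed.

Lemma peels_index : peels t n (peel_index t n d c) w b /\
  (peel_index t n d c <= n)%N.
Proof.
have [n2 [n3 n4]] := rank_bound hn; have NE := NNE n.
have [ab tb hl] := hlow; have ht := threshold_bounds t n.
have [hc hc'] := content_bounds.
have hodd : left_fork t -> odd d = abacus n w (NN n + 1).
  have := even_beads (t := t) hn mw; rewrite hQ size_rcons => h lf.
  exact: h.
rewrite /peel_index; case: rk_least => _ [[hb hc2]|[lf hb c2 a1]]; last first.
  have -> : (c == 1%N) = false by lia.
  by rewrite andbF lf c2 eqxx /=; split=> //; apply: peels_left_high.
have -> : (c == n.*2) = false by lia.
rewrite andbF.
have tE : threshold t n = NN n + (ref_diag t)%:Z by [].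
have lfE : left_fork t = (ref_diag t == 1%N) by case: (t).
case: ifP => [/andP[lf /eqP c1]|c1].
  have b2 : b = NN n + 2 by lia.
  (* If N + 1 is a bead, s_0^D removes N + 1 and N + 2 together; if it is a gap, s_1 moves b there.
     Since d is the number of live beads, its parity decides which case holds. *)
  have od := hodd lf; case: ifP => d2.
    by split=> //; apply: peels_left_low => //; rewrite -od.
  split; last lia.
  apply: (peels_middle hn mw hlow) => //; try lia.
  have -> : b - 1 = NN n + 1 by lia.
  by rewrite -od.
have gap1 : (0 < c)%N -> abacus n w (b - 1) = false.
  move=> c0; apply: hl; move: c1; rewrite lfE; have := ht; lia.
case: ifP => [/andP[rf /eqP c3]|c3].
  by split=> //; apply: peels_right_high => //; lia.
case: ifP => c4; last first.
  split; last lia.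
  by apply: (peels_middle hn mw hlow); rewrite ?gap1; lia.
split=> //; have [c0|c0] := posnP c.
  rewrite c0; apply: peels_zero => //; last lia.
  by rewrite lfE; lia.
have [cn|cn] := ltnP c n.
  by apply: (peels_middle hn mw hlow); rewrite ?gap1; lia.
have cE : c = n by lia.
case rf: (right_fork t).
  by rewrite cE; apply: peels_right_low => //; lia.
by apply: (peels_middle hn mw hlow); rewrite ?gap1 ?rf; lia.
Qed.

End PeelResidue.

Lemma live_ext t n w w' : mirrored n w -> mirrored n w' ->
  abacus n w =1 abacus n w' -> live_beads t n w = live_beads t n w'.
Proof.
move=> mw mw' ww'; apply: (irr_sorted_eq (leT := >%R)) => [x y z /=|x /=|||x];
  try lia; try exact: live_sorted.
by rewrite !mem_live // ww'.
Qed.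

Lemma bead_part_ext t n a a' b : a =1 a' -> bead_part t n a b = bead_part t n a' b.
Proof.
move=> aa; rewrite /bead_part /gaps_between (@eq_count _ (gap n a) (gap n a')) //.
by move=> e; rewrite /gap aa.
Qed.

Lemma shift_peel_index t n d c : (min_rank t <= n)%N -> (ref_diag t <= c)%N ->
  (c < n.*2)%N || left_fork t && (c == n.*2) ->
  shift t n (peel_index t n d c) =
  if left_fork t && (c == 1%N) then if odd d then 3 else 1
  else if left_fork t && (c == n.*2) then 3
  else if right_fork t && ((c == n.+1) || (c == n)) then 2
  else if c == 0%N then 2 else 1.
Proof.
move=> hn hc cn; have [n2 [n3 n4]] := rank_bound hn.
have s0 : shift t n 0 = if left_fork t then 3 else 2 by [].
have sn : shift t n n = if right_fork t then 2 else 1.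
  by rewrite /shift eqxx; have -> : (n == 0%N) = false by lia.
have sm k : (0 < k < n)%N -> shift t n k = 1.
  move=> hk; rewrite /shift; have -> : (k == 0%N) = false by lia.
  by have -> : (k == n) = false by lia.
have lfE : left_fork t = (ref_diag t == 1%N) by case: (t).
rewrite /peel_index; case: ifP => [/andP[lf _]|h1].
  by case: ifP => _; rewrite ?s0 ?lf ?sm //; lia.
case: ifP => [/andP[lf _]|h2]; first by rewrite s0 lf.
have [cn1|cn1] := eqVneq c n.+1.
  case rf: (right_fork t); first by rewrite sn rf.
  by rewrite /= cn1 ltnn sm //; lia.
have [cn2|cn2] := eqVneq c n.
  rewrite andbF andbT cn2 leqnn sn; case: right_fork => //.
  by have -> : (n == 0%N) = false by lia.
rewrite !andbF; have [c0|c0] := eqVneq c 0%N.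
  rewrite c0 s0 ifF //.
  by apply/negbTE; move: hc; rewrite c0 lfE; lia.
by case: ifP => cn3; rewrite sm //; lia.
Qed.

(** * The parts before and after a step *)

Section Step.

Variables (t : affine_type) (n : nat) (w u : int -> int) (Q : seq int) (b : int).
Hypotheses (hn : (min_rank t <= n)%N) (gw : in_group t n w)
  (hQ : live_beads t n w = rcons Q b).

Let d := (size Q).+1.
Let c := `|rk n b|%N.
Let r := peel_index t n d c.
Let s := gen t n r.

Hypotheses (mu : mirrored n u)
  (hu : abacus n u =1 abacus n (gen t n r \o w)).

Let mw : mirrored n w := let: And3 mw _ _ := gw in mw.
Let hlow : least t n w b := least_live mw hQ.
Let rn : (r <= n)%N := (peels_index hn gw hQ).2.
Let hp : peels t n r w b := (peels_index hn gw hQ).1.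

Let part (v : int -> int) (e : int) : int * bool := bead_part t n (abacus n v) e.

Lemma step_down : s b = b - shift t n r.
Proof.
have h := peels_low hp; rewrite /s gen_spec //; case: ifP => [h'|_]; last by rewrite h.
by have := low_sub_shift hn rn h'; rewrite h.
Qed.

Lemma live_step : live_beads t n u =
  [seq s e | e <- Q] ++ (if threshold t n < s b then [:: s b] else [::]).
Proof.
rewrite (live_ext t mu (step_mirrored hn rn mw) hu).
exact: (step_live hn rn mw hlow hp hQ).
Qed.

Lemma live_above e : e \in Q -> abacus n w e /\ b < e.
Proof.
move=> eQ; have : e \in rcons Q b by rewrite mem_rcons inE eQ orbT.
rewrite -hQ mem_live // => /andP[ae he]; split=> //.
have := live_sorted t n w; rewrite hQ -rev_sorted rev_rcons /= => hs.
by have /allP/(_ e) := order_path_min lt_trans hs; rewrite mem_rev; apply.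
Qed.

Lemma part_step e : e \in Q -> (part u (s e)).1 = (part w e).1.
Proof.
move=> /live_above[ae be]; rewrite /part (bead_part_ext _ _ _ hu).
exact: (step_part hn rn mw hlow hp ae be).
Qed.

Lemma least_step : threshold t n < s b -> least t n u (s b).
Proof.
move=> h; apply: (@least_live t n u [seq s e | e <- Q]) => //.
by rewrite live_step h cats1.
Qed.

Let partE : (part w b).1 =
  if NN n + NN n < b then NN n - 1 + x0 t + xn t
  else if NN n + n%:Z < b then b - NN n + x0 t + xn t else b - NN n + x0 t :=
  least_part hn mw hlow.

Let xs : (x0 t = - (ref_diag t)%:Z) /\ (xn t = - (right_fork t : nat)%:Z) /\
  left_fork t = (ref_diag t == 1%N) /\ (ref_diag t <= 1)%N.
Proof. by case: (t). Qed.

(** The formula of [least_part] compensates for shifts greater than one while b stays live: x_n = -1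
    absorbs one of the two positions moved by s_n^D across N + n, and the part N - 1 + x_0 + x_n at
    2N + 1 is one more than that at 2N - 2. If b stops being live, its part was 1. *)
Lemma drop_part : (part w b).1 =
  1 + (if threshold t n < s b then (part u (s b)).1 else 0).
Proof.
have [xE [yE [lE r1]]] := xs; have [n2 [n3 n4]] := rank_bound hn.
have [hc cn] := content_bounds hn gw hQ; have NE := NNE n.
have sE := shift_peel_index d hn hc cn; rewrite -/c -/r in sE.
have tE : threshold t n = NN n + (ref_diag t)%:Z by [].
have hpart := least_part hn mu (least_step _).
have [_ hb] := rk_least hn gw hQ; rewrite -/c in hb hc cn.
have sb := step_down; rewrite sE in sb; clear sE.
rewrite partE; move: hb hc cn sb hpart; clear partE tE.
have -> : threshold t n = NN n + (ref_diag t)%:Z by [].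
rewrite xE yE lE in n3 n4 *.
move: (c) (s b) => x y hb hc cn yb.
case: (ltP (NN n + (ref_diag t)%:Z) y) => hs hpart; last first.
  move: hs; rewrite yb; clear hpart yb.
  case: hb => [[hb hc2]|[l hb hc2 _]]; do !case: ifP => ?; lia.
rewrite hpart //; move: hs; rewrite yb; clear hpart yb.
by case: hb => [[hb hc2]|[l hb hc2 _]]; do !case: ifP => ?; lia.
Qed.

End Step.

Lemma peel_index_n t n d c : (min_rank t <= n)%N -> right_fork t ->
  (c <= n.*2)%N -> peel_index t n d c = n -> c = n \/ c = n.+1.
Proof.
move=> hn rf; have n3 := (rank_bound hn).2.1; rewrite rf orbT in n3.
have {}n3 := n3 isT; rewrite /peel_index rf; clear hn.
by do !case: ifP; lia.
Qed.

Lemma peel_index_0 t n d c : (min_rank t <= n)%N -> left_fork t ->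
  (ref_diag t <= c)%N -> (c <= n.*2)%N -> peel_index t n d c = 0%N ->
  c = 1%N /\ odd d \/ c = n.*2.
Proof.
move=> hn lf; have n2 := (rank_bound hn).1.
have -> : ref_diag t = 1%N by move: lf; case: (t).
rewrite /peel_index lf /=; clear hn.
case: eqVneq => [->|_]; first by case: ifP => // _ _ _ _; left.
by case: eqVneq => [->|_]; first (by right); do !case: ifP; lia.
Qed.

(** * The recorded box *)

Section RecordedBox.

Variables (t : affine_type) (n : nat) (w u : int -> int) (Q : seq int) (b : int).
Hypotheses (hn : (min_rank t <= n)%N) (gw : in_group t n w)
  (hQ : live_beads t n w = rcons Q b).

Let d := (size Q).+1.
Let c := `|rk n b|%N.
Let r := peel_index t n d c.
Let s := gen t n r.

Hypotheses (mu : mirrored n u)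
  (hu : abacus n u =1 abacus n (gen t n r \o w)).

Let live_u := live_step hn gw hQ mu hu.

Lemma row_len_next : threshold t n < s b ->
  (row_len (core n u) d)%:Z = d%:Z + rk n (s b).
Proof.
move=> h; have := @row_len_live t n u hn mu (size Q).
rewrite live_u h size_cat size_map addn1 ltnSn nth_cat size_map ltnn subnn.
exact.
Qed.

Lemma row_len_gone : s b <= threshold t n ->
  (row_len (core n u) d < d + ref_diag t)%N.
Proof.
move=> h; apply: (row_len_dead hn mu).
by rewrite live_u ltNge h cats0 size_map.
Qed.

Lemma rk_next : threshold t n < s b ->
  rk n (s b) = s b - NN n - 1 /\ rk n (s b) < c%:Z.
Proof.
move=> h; have [_ hb] := rk_least hn gw hQ; rewrite -/c in hb.
have sb := step_down hn gw hQ; rewrite -/c -/d -/r -/s in sb.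
have ht := threshold_bounds t n; have sd := shift_bounds t n r.
have [h1 h2] : s b <= NN n + NN n /\ s b - NN n - 1 < c%:Z.
  case: hb => [[hb hc]|[lf hb hc _]]; first lia.
  have [hc1 cn] := content_bounds hn gw hQ; rewrite -/c in hc1 cn.
  have := shift_peel_index d hn hc1 cn; rewrite -/r lf hc eqxx /=.
  have NE := NNE n; rewrite ifF; last by have := (rank_bound hn).1; lia.
  by move=> s3; rewrite sb s3 hb; clear -NE; lia.
by rewrite rk_small //; lia.
Qed.

(** The box lies to the right of what remains of row d, hence of every box recorded there later. If
    b stops being live, no later box is recorded in row d, so the last bound is restricted to live
    b. *)
Lemma recorded_box c' : recorded t n r (core n w) (core n u) c' ->
  [/\ c'.1 = d, (c'.2 <= row_len (core n w) d)%N &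
      threshold t n < s b -> (row_len (core n u) d < c'.2)%N].
Proof.
have rE : ref_row t (core n w) = d by rewrite (ref_rowE hn) ?hQ ?size_rcons //; case: gw.
rewrite /recorded /removed_box rE.
case: ifP => _; first by move=> /andP[/andP[/eqP-> /andP[h1 h2]] _].
case: ifP => _; first by move=> /andP[/andP[/andP[/eqP-> /andP[h1 h2]] _] _].
move=> /eqP->; rewrite (end_boxE hn gw hQ) /= (row_len_least hn gw hQ); split=> // hs.
have := row_len_next hs; have [_] := rk_next hs; rewrite -/c -/d.
by move: (rk n (s b)) (row_len _ _) (c) => x y z; lia.
Qed.

Lemma recorded_ex : exists c', recorded t n r (core n w) (core n u) c'.
Proof.
have rE : ref_row t (core n w) = d.
  by rewrite (ref_rowE hn) ?hQ ?size_rcons //; case: gw.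
have rl := row_len_least hn gw hQ; rewrite -/d -/c in rl.
have [_ hb] := rk_least hn gw hQ; rewrite -/c in hb.
have sb := step_down hn gw hQ; rewrite -/c -/d -/r -/s in sb.
have [hc cn] := content_bounds hn gw hQ; rewrite -/c in hc cn.
have c2n : (c <= n.*2)%N by case/orP: cn => [/ltnW|/andP[_ /eqP->]].
have sE := shift_peel_index d hn hc cn; rewrite -/r in sE.
have ht := threshold_bounds t n; have NE := NNE n.
rewrite /recorded /removed_box rE rl.
case h1: (right_fork t && (r == n)).
  have [rf /eqP rn] := andP h1.
  have cE := peel_index_n hn rf c2n rn.
  have n3 : (3 <= n)%N by apply: (rank_bound hn).2.1; rewrite rf orbT.
  have s2 : shift t n r = 2.
    have e1 : (c == 1%N) = false by clear -cE n3; lia.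
    have e2 : (c == n.*2) = false by clear -cE n3; lia.
    by rewrite sE rf e1 e2 !andbF; case: cE => ->; rewrite eqxx ?orbT.
  have bE : b = NN n + 1 + c%:Z.
    by case: hb => [[_ h]|[_ _ h _]]; clear -h cE n3 NE; lia.
  have hs : threshold t n < s b by rewrite sb s2; clear -bE cE n3 ht; lia.
  (* s_n^D removes the boxes on the diagonals n - 1 and n if c = n, and on n and n + 1 otherwise;
     the one off diagonal n is recorded. *)
  exists (d, if c == n then (d + n - 1)%N else (d + n.+1)%N); rewrite /diag /= eqxx /=.
  have := row_len_next hs; have [-> _] := rk_next hs; rewrite sb s2.
  move: (row_len _ _) => y; clear -bE cE n3.
  by case: cE => cE; rewrite cE in bE *; case: eqP; lia.
case h2: (left_fork t && (r == 0%N)); last by exists (end_box t (core n w)).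
have [lf /eqP r0] := andP h2; have n2 := (rank_bound hn).1.
have lE : ref_diag t = 1%N by move: lf; case: (t).
have cE := peel_index_0 hn lf hc c2n r0.
have s3 : shift t n r = 3.
  rewrite sE lf; case: cE => [[-> ->] //|->]; rewrite eqxx /=.
  by have -> : (n.*2 == 1%N) = false by clear; lia.
(* s_0^D removes the boxes on the diagonals 0 and 1 if c = 1, and on 2n - 1 and 2n otherwise; those
   on 0 and 2n are not recorded. *)
exists (d, if c == 1%N then d.+1 else (d + n.*2 - 1)%N); rewrite /diag /= eqxx /=.
case: cE => [[c1 od]|c2].
  have bE : b = NN n + 2 by case: hb => [[_ h]|[_ _ h _]]; clear -h c1 n2; lia.
  have hs : s b <= threshold t n.
    by rewrite sb s3 /threshold lE; clear -bE; lia.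
  by have := row_len_gone hs; rewrite c1 eqxx lE; clear -n2; lia.
have b2 : b = NN n + NN n + 1.
  by case: hb => [[h h']|[_ h _ _]]; clear -h h' c2 NE || clear -h; lia.
have hs : threshold t n < s b by rewrite sb s3; clear -b2 ht NE n2; lia.
have := row_len_next hs; have [-> _] := rk_next hs; rewrite sb s3.
have -> : (c == 1%N) = false by clear -c2 n2; lia.
by move: (row_len _ _) => y; clear -b2 c2 n2 NE; lia.
Qed.

End RecordedBox.

(** * The upper diagram *)

Lemma row_cols_cons (U : seq (box * nat)) x i :
  row_cols (x :: U) i =
  if x.1.1 == i then
    if x.1.2 \in row_cols U i then row_cols U i else x.1.2 :: row_cols U i
  else row_cols U i.
Proof. by rewrite /row_cols /=; case: eqP => //= _; rewrite mem_undup. Qed.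

Lemma mem_row_cols (U : seq (box * nat)) i y :
  y \in row_cols U i -> exists2 x, x \in U & x.1 = (i, y).
Proof.
rewrite mem_undup => /mapP[x]; rewrite mem_filter => /andP[/eqP xi xU] ->.
by exists x => //; rewrite -xi; case: (x.1).
Qed.

Lemma row_count_out (U : seq (box * nat)) m i :
  (forall x, x \in U -> x.1.1 <= m)%N -> (m < i)%N -> row_cols U i = [::].
Proof.
move=> hU mi; case hc: (row_cols U i) => [|y s] //.
have : y \in row_cols U i by rewrite hc mem_head.
by move=> /mem_row_cols[x /hU] + xE; rewrite xE /=; lia.
Qed.

(** Rows without boxes cannot have the positive star size, so any bound D on the rows may replace
    the largest row. This allows two diagrams to be compared over the same range. *)
Lemma starredE t n (U : seq (box * nat)) i D : (0 < star_size t n)%N ->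
  (forall x, x \in U -> x.1.1 <= D)%N ->
  starred t n U i =
  [&& right_fork t, row_count U i == star_size t n,
      all (fun j => (i < j)%N ==> (row_count U j != star_size t n)) (iota 1 D)
    & ((i, (\max_(j <- row_cols U i) j)%N), n.-1) \in U].
Proof.
move=> K0 hU; rewrite /starred /diagram_rows; set m := (\max_(x <- U) x.1.1)%N.
have mD : (m <= D)%N by apply/bigmax_leqP_seq => x xU _; apply: hU.
have hm x : x \in U -> (x.1.1 <= m)%N by move=> xU; apply: leq_bigmax_seq.
rewrite -(subnKC mD) iotaD all_cat.
rewrite [X in [&& _, _, _ && X & _]](_ : _ = true) ?andbT //.
apply/allP => j; rewrite mem_iota => hj; apply/implyP => _.
by rewrite /row_count (row_count_out hm) //=; lia.
Qed.

(** The invariant of the induction along a peeling. The second clause bounds the columns of the last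
    live row, to which the preceding step may add a box: it ensures that this box is new. *)
Definition describes (t : affine_type) (n : nat) (w : int -> int)
    (U : seq (box * nat)) : Prop :=
  let Q := live_beads t n w in
  let part e := bead_part t n (abacus n w) e in
  [/\ forall x, x \in U -> (0 < x.1.1 <= size Q)%N,
      forall x, x \in U -> x.1.1 = size Q ->
        (x.1.2 <= row_len (core n w) (size Q))%N,
      forall i, (i < size Q)%N -> (row_count U i.+1)%:Z = (part (nth 0 Q i)).1
    & forall i, (i < size Q)%N -> starred t n U i.+1 = (part (nth 0 Q i)).2].

Lemma star_sizeE t n : (min_rank t <= n)%N -> right_fork t ->
  (star_size t n)%:Z = n%:Z + x0 t /\ (0 < star_size t n)%N /\ (3 <= n)%N.
Proof. by case: t => //= ? _; rewrite /star_size /=; lia. Qed.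

(** With x_n = -1 the two size formulas agree at N + n and N + n + 1. The star tells these two beads
    apart. *)
Lemma part_star t n w b : (min_rank t <= n)%N -> mirrored n w ->
  right_fork t -> least t n w b ->
  let p := (bead_part t n (abacus n w) b).1 in
  (p = star_size t n <-> b = NN n + n%:Z \/ b = NN n + n%:Z + 1) /\
  (p = (star_size t n)%:Z + 1 -> b = NN n + n%:Z + 2).
Proof.
move=> hn mw rf lb /=; rewrite (least_part hn mw lb).
have [-> [_ n3]] := star_sizeE hn rf; have NE := NNE n.
have xE : xn t = -1 by move: rf; case: (t).
have x2 : NN n + NN n < b -> (4 <= n)%N.
  case: (least_bound mw lb) => [h h'|[lf _ _] _]; first by clear -h h'; lia.
  by apply: (rank_bound hn).2.2; rewrite lf rf.
rewrite xE; move: (x0 t) => x; clear -n3 NE x2.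
case: ifP => h1; [have {}x2 := x2 h1; lia|case: ifP => h2; lia].
Qed.

Lemma bead_part2 t n a b :
  (bead_part t n a b).2 = right_fork t && (b == NN n + n%:Z).
Proof.
rewrite /bead_part; case: ltP => h /=; last by [].
by rewrite (gt_eqF h) andbF.
Qed.

Section Invariant.

Variables (t : affine_type) (n : nat) (w u : int -> int) (Q : seq int) (b : int).
Hypotheses (hn : (min_rank t <= n)%N) (gw : in_group t n w)
  (hQ : live_beads t n w = rcons Q b).

Let d := (size Q).+1.
Let c := `|rk n b|%N.
Let r := peel_index t n d c.
Let s := gen t n r.

Hypotheses (mu : mirrored n u)
  (hu : abacus n u =1 abacus n (gen t n r \o w)).

Variables (U : seq (box * nat)) (x : box).
Hypotheses (hU : describes t n u U)
  (hx : recorded t n r (core n w) (core n u) x).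

Let live_u := live_step hn gw hQ mu hu.
Let mw : mirrored n w := let: And3 mw _ _ := gw in mw.
Let hlow : least t n w b := least_live mw hQ.
Let part e := bead_part t n (abacus n w) e.
Let V := (x, r) :: U.

Lemma size_live_u :
  size (live_beads t n u) = (size Q + (threshold t n < s b)%R)%N.
Proof. by rewrite live_u size_cat size_map; case: ifP. Qed.

Lemma nth_live_u i : (i < size Q)%N ->
  nth 0 (live_beads t n u) i = s (nth 0 Q i).
Proof. by move=> hi; rewrite live_u nth_cat size_map hi (nth_map 0). Qed.

Lemma rows_U y : y \in U -> (0 < y.1.1 <= d)%N.
Proof.
have [h _ _ _] := hU; move=> /h; rewrite size_live_u /d.
by case: (_ < _) => /=; lia.
Qed.

Lemma row_x : x.1 = d.
Proof. by case: (recorded_box hn gw hQ mu hu hx). Qed.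

Lemma cols_U y : y \in row_cols U d -> (y < x.2)%N.
Proof.
have [h1 h2 _ _] := hU; move=> /mem_row_cols[z zU zE].
have := h1 _ zU; have := h2 _ zU; rewrite zE /= size_live_u.
case: (boolP (threshold t n < s b)) => hs; last first.
  by rewrite addn0 /d; clear; lia.
rewrite addn1 => /(_ erefl) h _; apply: leq_ltn_trans h _.
by have [_ _ ] := recorded_box hn gw hQ mu hu hx; apply.
Qed.

Lemma row_cols_x : row_cols V d = x.2 :: row_cols U d.
Proof.
rewrite row_cols_cons /= row_x eqxx ifF //.
by apply/negP => /cols_U; rewrite ltnn.
Qed.

Lemma row_cols_other i : i != d -> row_cols V i = row_cols U i.
Proof. by move=> h; rewrite row_cols_cons /= row_x eq_sym (negbTE h). Qed.

Lemma row_count_x : (row_count V d)%:Z = (part b).1.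
Proof.
rewrite /part (drop_part hn gw hQ mu hu) /row_count row_cols_x /=.
have [h1 _ h3 _] := hU.
case: ifP => hs.
  have := h3 (size Q); rewrite live_u hs size_cat size_map addn1 ltnSn.
  rewrite nth_cat size_map ltnn subnn /= => /(_ isT) <-.
  by rewrite /row_count -/d -addn1 PoszD addrC.
rewrite (@row_count_out _ (size Q)) // => y /h1.
by rewrite size_live_u hs addn0 => /andP[].
Qed.

Lemma nth_above i : (i < size Q)%N -> abacus n w (nth 0 Q i) /\ b < nth 0 Q i.
Proof. by move=> hi; apply: (live_above gw hQ); apply: mem_nth. Qed.

Lemma row_count_other i : (i < size Q)%N ->
  (row_count V i.+1)%:Z = (part (nth 0 Q i)).1.
Proof.
move=> hi; have [_ _ h3 _] := hU.
rewrite /row_count row_cols_other; last by rewrite /d; clear -hi; lia.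
rewrite -/(row_count _ _) h3; last by rewrite size_live_u; clear -hi; lia.
rewrite nth_live_u // (part_step hn gw hQ hu) //; exact: mem_nth.
Qed.

Lemma rows_V y : y \in V -> (y.1.1 <= d)%N.
Proof.
by rewrite inE => /orP[/eqP->|/rows_U/andP[]//]; rewrite /= row_x.
Qed.

(** Row d is the last row and [x] its rightmost box, so the star depends on the size and on r. Of
    the two beads giving the star size, N + n has content n - 1 and residue n - 1, while N + n + 1
    has content n and residue n. *)
Lemma starred_x : right_fork t -> starred t n V d = (b == NN n + n%:Z).
Proof.
move=> rf; have [KE [K0 n3]] := star_sizeE hn rf.
rewrite (starredE _ K0 rows_V) rf /=.
rewrite [all _ _](_ : _ = true) /=; last first.
  by apply/allP => j; rewrite mem_iota => hj; apply/implyP; clear -hj; lia.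
have maxE : (\max_(j <- row_cols V d) j)%N = x.2.
  rewrite row_cols_x big_cons; apply/maxn_idPl/bigmax_leqP_seq => j /cols_U h _.
  exact: ltnW.
have memE : (((d, x.2), n.-1) \in V) = (n.-1 == r).
  have xE : (d, x.2) = x by rewrite -row_x; case: (x).
  rewrite xE inE xpair_eqE eqxx /=; apply/orb_idr => xU.
  have : x.2 \in row_cols U d.
    by rewrite mem_undup; apply/mapP; exists (x, n.-1) => //; rewrite mem_filter /= row_x eqxx.
  by move=> /cols_U; rewrite ltnn.
rewrite maxE memE.
have -> : (row_count V d == star_size t n) =
    (b == NN n + n%:Z) || (b == NN n + n%:Z + 1).
  have [h _] := part_star hn mw rf hlow; move: h; rewrite -/(part b) -row_count_x => h.
  apply/eqP/orP => [h'|h'].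
    by have [->|->] := h.1 (congr1 Posz h'); rewrite eqxx; [left|right].
  by have /h[] : b = NN n + n%:Z \/ b = NN n + n%:Z + 1 by case: h' => /eqP; [left|right].
have [_ hb] := rk_least hn gw hQ; rewrite -/c in hb.
have NE := NNE n.
have [bE|bE] := eqVneq b (NN n + n%:Z).
  have cE : c = n.-1.
    by case: hb => [[_ h]|[_ h _ _]]; clear -h bE n3 NE; lia.
  rewrite /r cE /peel_index.
  have -> : (n.-1 == 1%N) = false by clear -n3; lia.
  have -> : (n.-1 == n.*2) = false by clear -n3; lia.
  have -> : (n.-1 == n.+1) = false by clear -n3; lia.
  by rewrite !andbF leq_pred eqxx.
have [bE'|//] := eqVneq b (NN n + n%:Z + 1).
have cE : c = n.
  by case: hb => [[_ h]|[_ h _ _]]; clear -h bE' n3 NE; lia.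
rewrite /r cE /peel_index.
have -> : (n == 1%N) = false by clear -n3; lia.
have -> : (n == n.*2) = false by clear -n3; lia.
have -> : (n == n.+1) = false by clear -n3; lia.
by rewrite !andbF leqnn; clear -n3; lia.
Qed.

Lemma starred_other i : right_fork t -> (i < size Q)%N ->
  starred t n V i.+1 = (nth 0 Q i == NN n + n%:Z).
Proof.
move=> rf hi; have [KE [K0 n3]] := star_sizeE hn rf; have NE := NNE n.
have [ae be] := nth_above hi; set e := nth 0 Q i in ae be *.
have [hK hK1] := part_star hn mw rf hlow; rewrite -/(part b) in hK hK1.
have rx := row_count_x; have ro := row_count_other hi; rewrite -/e in ro.
have di : i.+1 != d by rewrite /d; clear -hi; lia.
have id : (i.+1 < d)%N by rewrite /d.
have dD : d \in iota 1 d by rewrite mem_iota /d; clear; lia.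
(* Row d has the star size and lies below row i + 1, which therefore bears no star; and b is at
   least N + n, so e differs from N + n. *)
have [cdK|cdK] := eqVneq (row_count V d) (star_size t n).
  rewrite (starredE _ K0 rows_V) (_ : all _ _ = false); last first.
    by apply/negP => /allP/(_ d dD); rewrite id cdK eqxx.
  rewrite !andbF; apply/esym/negbTE.
  have : b = NN n + n%:Z \/ b = NN n + n%:Z + 1 by apply/hK; rewrite -rx cdK.
  by clear -be; lia.
(* Row d of [U] has the star size here and suppresses the stars above it, so [U] and [V] cannot be
   compared clause by clause. But [tops_before] is monotone, so the part of e is at least that of b,
   too large for a star. *)
have [cdK1|cdK1] := eqVneq (row_count V d) (star_size t n).+1.
  have bE : b = NN n + n%:Z + 2 by apply: hK1; rewrite -rx cdK1; clear; lia.
  rewrite (gt_eqF (_ : NN n + n%:Z < e)); last by clear -be bE; lia.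
  rewrite (starredE _ K0 rows_V).
  rewrite (_ : (row_count V i.+1 == star_size t n) = false) ?andbF //.
  apply/eqP => h; move: ro rx; rewrite h cdK1 /part /bead_part.
  have -> : NN n + n%:Z < e by clear -be bE; lia.
  have -> : NN n + n%:Z < b by clear -bE; lia.
  have [ab _ _] := hlow.
  rewrite !gaps_bead //= => h1 h2.
  have : b - NN n <= e - NN n by clear -be; lia.
  move=> /(tops_before_le n w); move: h1 h2; clear.
  by move: (tops_before _ _ _) (tops_before _ _ _) => p q; lia.
(* Now row d has the star size neither in [V] nor in [U], so it affects no other star. *)
have [_ _ _ h4] := hU; have := h4 i; rewrite size_live_u.
have -> : (i < size Q + (threshold t n < s b)%R)%N by clear -hi; lia.
move=> /(_ isT); rewrite bead_part2 rf /= nth_live_u // -/e.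
have -> : (s e == NN n + n%:Z) = (e == NN n + n%:Z).
  have [hp rn] := peels_index hn gw hQ.
  have [en|en] := leP e (NN n + n%:Z); first by rewrite /s (peels_fix hp ae be en).
  rewrite (gt_eqF en); apply/negbTE/eqP => se.
  have [|_ _ bE _] := peels_fork hp ae be en; first by rewrite -/s se.
  case/eqP: cdK; suff : (row_count V d)%:Z = star_size t n by case.
  by rewrite rx hK; right.
move=> <-; rewrite (starredE _ K0 rows_V) (starredE _ (D := d) K0); last first.
  by move=> y /rows_U/andP[].
have cE j : j != d -> row_count V j = row_count U j.
  by move=> jd; rewrite /row_count row_cols_other.
rewrite cE // row_cols_other //; congr [&& _, _, _ & _].
  apply: eq_in_all => j _; have [->|jd] := eqVneq j d; last by rewrite cE.
  rewrite id cdK /=; apply/esym; apply: contra cdK1.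
  by rewrite /row_count row_cols_x /= => /eqP->.
rewrite inE xpair_eqE; case: (x) row_x => x1 x2 /= ->.
by rewrite xpair_eqE (negbTE di).
Qed.

Lemma describes_step : describes t n w V.
Proof.
have sQ : size (live_beads t n w) = d by rewrite hQ size_rcons.
split; rewrite ?sQ.
- move=> y; rewrite inE => /orP[/eqP->|/rows_U //]; rewrite /= row_x; exact: leqnn.
- move=> y; rewrite inE => /orP[/eqP-> _|yU yd].
    by have [_ h _] := recorded_box hn gw hQ mu hu hx.
  have [_ h _] := recorded_box hn gw hQ mu hu hx; apply: leq_trans h.
  apply: ltnW; apply: cols_U; rewrite mem_undup; apply/mapP.
  by exists y => //; rewrite mem_filter yd eqxx.
- move=> i; rewrite hQ nth_rcons ltnS leq_eqVlt => /orP[/eqP->|hi].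
    by rewrite ltnn eqxx row_count_x.
  by rewrite hi row_count_other.
move=> i; rewrite bead_part2; case rf: (right_fork t); last by rewrite /starred rf.
rewrite hQ nth_rcons ltnS leq_eqVlt => /orP[/eqP->|hi].
  by rewrite ltnn eqxx starred_x.
by rewrite hi starred_other.
Qed.

End Invariant.

(** * The invariant along a peeling, and termination *)

Lemma live_nil t n w : (min_rank t <= n)%N -> in_group t n w ->
  live_beads t n w = [::] -> core n w = [::].
Proof.
move=> hn gw h0; have [mw _ _] := gw.
suff h1 : row_len (core n w) 1 = 0%N.
  move: h1; rewrite coreE /row_len /coreR /=; case hs: (filter _ _) => [|m l] //=.
  have : m \in m :: l by rewrite mem_head.
  by rewrite -hs mem_filter => /andP[+ _]; case: m {hs}.
have := @row_len_dead t n w hn mw 0; rewrite h0 => /(_ isT).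
case hl: (left_fork t); last first.
  have -> : ref_diag t = 0%N by move: hl; case: (t).
  by case: (row_len _ _).
(* With the first diagonal as reference, a nonempty core could a priori miss it; its largest bead
   would then be N + 1, which parity rules out. *)
have := even_beads hn mw hl gw; rewrite h0 /= => a1 _.
have [s es hs] := live_prefix t n w; rewrite h0 /= in es.
have [hB|hB] := posnP (size (beadsR (abacus n w) (radius n w))).
  by rewrite coreE row_len_core0 // hB.
have := row_len_core (abacus_good mw) hB; rewrite -coreE.
have := mem_nth 0 hB; rewrite {2}es; set e := nth _ _ _ => eB.
have ae : abacus n w e by move: (mem_nth 0 hB); rewrite mem_beadsR => /andP[].
have := allP hs e eB; rewrite /threshold => /= ht.
have ee := good_entry (abacus_good mw) ae.
have r1 : ref_diag t = 1%N by move: hl; case: (t).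
have eN : e < NN n.
  have [_ [eN _]] := entryP ee.
  have : e != NN n + 1 by apply: contraTneq ae => ->; rewrite -a1.
  by move: ht eN; rewrite r1; clear; lia.
have := lt_rk ee eN; have -> : rk n (NN n) = 0 by rewrite /rk lexx /cnt subrr.
by move: (rk n e) (row_len _ _) => p q; clear; lia.
Qed.

Lemma core_live t n w : (min_rank t <= n)%N -> in_group t n w ->
  core n w <> [::] -> exists Q b, live_beads t n w = rcons Q b.
Proof.
move=> hn gw; case/lastP: (live_beads t n w) (live_nil hn gw) => [h|Q b _ _].
  by move/(_ (h erefl)).
by exists Q, b.
Qed.

Lemma describes_nil t n w : live_beads t n w = [::] -> describes t n w [::].
Proof. by move=> h; rewrite /describes h; split. Qed.

Lemma describes_parts t n w U : (min_rank t <= n)%N -> mirrored n w ->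
  describes t n w U ->
  [seq (Posz p.1, p.2) | p <- diagram_parts t n U] = abacus_parts t n w.
Proof.
move=> hn mw [h1 _ h3 h4]; have ht := threshold_bounds t n.
set Q := live_beads t n w in h1 h3 h4; pose part := bead_part t n (abacus n w).
have pQ e : e \in Q -> 1 <= (part e).1.
  by rewrite mem_live // => /andP[ae he]; apply: part_ge.
have -> : abacus_parts t n w = [seq part e | e <- Q].
  rewrite /abacus_parts filter_map; congr map.
  rewrite -filter_predI; apply: eq_in_filter => e /=.
  rewrite beads_descE mem_beadsR => /andP[ae _] /=.
  case: (ltP (NN n) e) => he; last by rewrite andbF; apply/esym/negbTE; lia.
  rewrite andbT; case: (ltP (threshold t n) e) => he'.
    by have := part_ge hn mw ae he'; rewrite -/(part e); clear; lia.
  (* The only possible bead above N that is not live is N + 1 with x_0 = -1; its part is zero and is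
     filtered out. *)
  have [r1 eE] : ref_diag t = 1%N /\ e = NN n + (ref_diag t)%:Z.
    have rt : (ref_diag t <= 1)%N by case: (t).
    move: he' he rt; rewrite /threshold; clear; lia.
  have x1 : x0 t = -1 by move: r1; case: (t).
  rewrite /bead_part ifN /=; last by rewrite eE r1; have := rank_bound hn; lia.
  by rewrite eE r1 x1; clear; lia.
(* The part of the last live bead is positive, so its row contains a box and is the largest row of
   the diagram. *)
have max_rows : diagram_rows U = iota 1 (size Q).
  congr iota; apply/eqP; rewrite eqn_leq; apply/andP; split.
    by apply/bigmax_leqP_seq => x /h1/andP[].
  case hs: (size Q) => [|m] //.
  have mQ : (m < size Q)%N by rewrite hs.
  have := h3 m mQ; have := pQ _ (mem_nth 0 mQ); rewrite /part => hp hr.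
  have : (0 < size (row_cols U m.+1))%N by move: hp; rewrite -hr /row_count; case: size.
  case hc: (row_cols _ _) => [|y l] // _.
  have /mem_row_cols[x xU xE] : y \in row_cols U m.+1 by rewrite hc mem_head.
  by rewrite -[m.+1]/((m.+1, y).1) -xE; apply: (leq_bigmax_seq (F := fun x => x.1.1)).
rewrite /diagram_parts max_rows.
have -> : [seq (row_count U i, starred t n U i) | i <- iota 1 (size Q)] =
          [seq (absz (part e).1, (part e).2) | e <- Q].
  apply: (@eq_from_nth _ (0%N, false)) => [|i]; rewrite !size_map size_iota // => hi.
  rewrite (nth_map 0%N) ?size_iota // nth_iota // (nth_map 0) // add1n h4 // -/(part _).
  by congr (_, _); rewrite /part -h3.
rewrite (_ : filter _ _ = [seq (absz (part e).1, (part e).2) | e <- Q]); last first.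
  by apply/all_filterP/allP => _ /mapP[e /pQ he ->] /=; move: he; clear; lia.
rewrite -map_comp; apply/eq_in_map => e /pQ he /=.
by rewrite [RHS]surjective_pairing; congr (_, _); move: he; clear; lia.
Qed.

(** The witness of [gen_acts] has the same core as [w], hence the same abacus, and passing to the
    representative of the new coset does not change the abacus either. *)
Lemma gen_acts_abacus t n k w mu : (min_rank t <= n)%N -> (k <= n)%N ->
  min_coset_rep t n w -> gen_acts t n k (core n w) mu ->
  exists u, [/\ min_coset_rep t n u, mu = core n u &
    abacus n u =1 abacus n (gen t n k \o w)].
Proof.
move=> hn hk [[mw _ _] _] [w0 [u [v [hw0 hu pv uE [wE ->]]]]].
exists u; split=> // e; have [[mw0 _ _] _] := hw0.
rewrite (abacus_ext n uE).
rewrite (abacus_parabolic hn _ pv); last exact: mirrored_comp (gen_mirrored hn hk) mw0.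
by rewrite !abacus_gen // (core_inj mw mw0 wE).
Qed.

Lemma peeling_describes t n w U : (min_rank t <= n)%N -> min_coset_rep t n w ->
  peeling t n (core n w) U -> describes t n w U.
Proof.
move=> hn hw; move cE: (core n w) => lam hU.
elim: hU w hw cE => [|{}lam mu r x {}U lam0 hr hact hx _ IH] w hw cE.
  apply: describes_nil; have [[mw _ _] _] := hw.
  exact: core_nil cE.
have [gw _] := hw; rewrite -cE in lam0 hr hact hx.
have [Q [b hQ]] := core_live hn gw lam0.
move: hr => /(peel_residueE hn gw hQ) rE.
have rn := (peels_index hn gw hQ).2; rewrite -rE in rn.
have [u [hu muE uE]] := gen_acts_abacus hn rn hw hact.
have [[mu' _ _] _] := hu.
rewrite rE in uE *; rewrite rE muE in hx.
apply: (describes_step hn gw hQ mu' uE _ hx).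
by apply: IH.
Qed.

(** Each step lowers the sum of the parts of the live beads by one. At sum zero no live bead is
    left, so the core is empty. *)
Lemma peeling_ex t n w : (min_rank t <= n)%N -> min_coset_rep t n w ->
  exists U, peeling t n (core n w) U.
Proof.
move=> hn.
pose total v := sumn [seq absz (bead_part t n (abacus n v) e).1 | e <- live_beads t n v].
move mE: (total w) => m; elim: m w mE => [|m IH] w mE hw; have [gw _] := hw;
  have [mw _ _] := gw.
  case hc: (core n w) => [|l s]; first by exists [::]; constructor.
  have [|Q [b hQ]] := @core_live t n w hn gw; first by rewrite hc.
  move: mE; rewrite /total hQ map_rcons -cats1 sumn_cat /=.
  have [ab tb _] := least_live mw hQ.
  by have := part_ge hn mw ab tb; lia.
case hc: (core n w) => [|l s]; first by exists [::]; constructor.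
have c0 : core n w <> [::] by rewrite hc.
have [Q [b hQ]] := core_live hn gw c0.
have rn := (peels_index hn gw hQ).2.
set r := peel_index _ _ _ _ in rn.
have [u [v [hu pv uE]]] := min_coset_rep_ex hn rn hw.
have [[mu _ _] _] := hu.
have aE : abacus n u =1 abacus n (gen t n r \o w).
  move=> e; rewrite (abacus_ext n uE).
  by rewrite (abacus_parabolic hn _ pv) //; apply: mirrored_comp (gen_mirrored hn rn) mw.
have [x hx] := recorded_ex hn gw hQ mu aE.
have [|U hU] := IH u _ hu.
  have := live_step hn gw hQ mu aE; have := drop_part hn gw hQ mu aE.
  have := part_step hn gw hQ aE.
  rewrite -/r => h1 h2 h3; apply: succn_inj; rewrite -mE /total h3 hQ.
  rewrite map_rcons map_cat -map_comp -cats1 !sumn_cat -addnS.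
  congr (_ + _)%N; first by congr sumn; apply/eq_in_map => e eQ /=; rewrite h1.
  have [ab tb _] := least_live mw hQ.
  rewrite /= addn0 h2; case: ifP => hs /=; last by [].
  have [au tu _] : least t n u (gen t n r b).
    by apply: (@least_live t n u [seq gen t n r e | e <- Q]); rewrite // h3 hs cats1.
  by have := part_ge hn mu au tu; lia.
exists ((x, r) :: U); rewrite -hc; apply: (Peeling_step c0 _ _ hx hU).
  by apply/(peel_residueE hn gw hQ).
by exists w, u, v.
Qed.

Theorem proposition7p4 (t : affine_type) (n : nat) (w : int -> int)
    (hn : (min_rank t <= n)%N) (hw : min_coset_rep t n w)
    (beta : seq (nat * bool)) :
  bounded_partition t n w beta <->
  [seq (Posz p.1, p.2) | p <- beta] = abacus_parts t n w.
Proof.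
have [[mw _ _] _] := hw.
have parts U : peeling t n (core n w) U ->
    [seq (Posz p.1, p.2) | p <- diagram_parts t n U] = abacus_parts t n w.
  by move=> /(peeling_describes hn hw); apply: describes_parts.
split=> [[U hU ->]|hb]; first exact: parts.
have [U hU] := peeling_ex hn hw; exists U => //.
have fI : injective (fun p : nat * bool => (Posz p.1, p.2)).
  by move=> [p1 p2] [q1 q2] [-> ->].
by apply: (inj_map fI); rewrite hb parts.
Qed.
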